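(* Each fixed-endpoint homotopy class of a path $c:I\rightarrow X$ in a metric space $X$ that is $1$-dimensional in some sense contains a unique (up to Fréchet equivalence) normal path $c_n$. In addition, $L(c_n)\leq L(c)$.
   Context: A path is a continuous map from a compact interval; $L(c)\in[0,\infty]$ is its length. Two paths $c_1,c_2$ are Fréchet equivalent if $c_1=c_2\circ h$ for an order-preserving homeomorphism $h$ between their domains. Paths are considered up to Fréchet equivalence: two paths are fixed-endpoint homotopic if there is a fixed-endpoint homotopy between Fréchet equivalent representatives with a common domain. The domain of a constant path is permitted to be a degenerate interval $[a,a]$ (it is identified for homotopy purposes with a constant path on an interval). A path $c:[a,b]\to X$ is normal if there is no nontrivial subsegment $J=[u,v]\subset[a,b]$ such that $c(u)=c(v)$ and $c|_J$ is homotopic (in $X$) to a constant relative to $\{u,v\}$ (so a normal constant path has degenerate domain). ''$X$ is $1$-dimensional in some sense'' means that at least one of the following dimensions of $X$ equals $1$: the small inductive dimension $\operatorname{ind}(X)$, the large inductive dimension $\operatorname{Ind}(X)$, the covering dimension $\dim(X)$, or the uniform dimension $u\dim(X)$. The uniform dimension is defined like the covering dimension except that the open covers involved are required to be uniform, where an open cover of a metric space is uniform if it is refined by the cover by all $\varepsilon$-balls for some $\varepsilon>0$. *)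

(* Defs.v *)
From HB Require Import structures.
From mathcomp Require Export all_boot all_order all_algebra.
From mathcomp Require Export all_classical all_reals all_analysis.

Set Implicit Arguments.
Unset Strict Implicit.
Unset Printing Implicit Defensive.

Import Order.TTheory GRing.Theory Num.Theory.
Import numFieldNormedType.Exports.

Local Open Scope classical_set_scope.
Local Open Scope ring_scope.

(** * Dimensions

    Every dimension function [d] is given by the family of predicates
    [d_lt n], meaning [d(T) < n], so that the value -1 of the empty space is
    covered by [n = 0]. *)

Definition frontier (T : topologicalType) (U : set T) : set T :=
  closure U `\` U°.

Fixpoint ind_lt (n : nat) (T : topologicalType) : Prop :=
  if n is m.+1 then
    forall (x : T) (V : set T), nbhs x V ->
      exists U : set T,
        [/\ open U, U x, U `<=` V & ind_lt m (set_type (frontier U))]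
  else [set: T] = set0.

Fixpoint Ind_lt (n : nat) (T : topologicalType) : Prop :=
  if n is m.+1 then
    forall A V : set T, closed A -> open V -> A `<=` V ->
      exists U : set T,
        [/\ open U, A `<=` U, U `<=` V & Ind_lt m (set_type (frontier U))]
  else [set: T] = set0.

Definition open_cover (T : topologicalType) (C : set (set T)) : Prop :=
  C `<=` open /\ \bigcup_(V in C) V = [set: T].

Definition refines (T : Type) (D C : set (set T)) : Prop :=
  forall V, D V -> exists2 U, C U & V `<=` U.

Definition multiplicity_le (T : Type) (C : set (set T)) (n : nat) : Prop :=
  forall x : T, ([set V | C V /\ V x] #<= `I_n)%card.

(* [dim T <= n-1] iff refinements of order [n-1] exist, that is, refinements
   in which every point belongs to at most [n] members. *)
Definition cdim_lt (n : nat) (T : topologicalType) : Prop :=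
  forall C : set (set T), open_cover C ->
    exists D, [/\ open_cover D, refines D C & multiplicity_le D n].

Definition uniform_cover (R : realType) (X : metricType R) (C : set (set X)) :
    Prop :=
  open_cover C /\
  exists2 e : R, 0 < e & refines [set ball x e | x in [set: X]] C.

Definition udim_lt (n : nat) (R : realType) (X : metricType R) : Prop :=
  forall C : set (set X), uniform_cover C ->
    exists D, [/\ uniform_cover D, refines D C & multiplicity_le D n].

(* [dim_eq (d_lt ^~ T) n] says [d(T) = n]. *)
Definition dim_eq (dim_lt : nat -> Prop) (n : nat) : Prop :=
  dim_lt n.+1 /\ ~ dim_lt n.

Definition one_dimensional (R : realType) (X : metricType R) : Prop :=
  [\/ dim_eq (ind_lt ^~ X) 1%N, dim_eq (Ind_lt ^~ X) 1%N,
      dim_eq (cdim_lt ^~ X) 1%N | dim_eq (fun n => udim_lt n X) 1%N].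

(** * Paths *)

(* Only the restriction of [cfun] to [[domL, domR]] is meaningful. *)
Record cpath (R : realType) (X : metricType R) := CPath {
  domL : R;
  domR : R;
  cfun :> R -> X;
  domLR : domL <= domR;
  cfun_continuous : {within `[domL, domR], continuous cfun}
}.

Section Paths.
Context {R : realType} {X : metricType R}.
Implicit Types c d : cpath X.

Definition plength c : \bar R :=
  ereal_sup [set (\sum_(0 <= i < size s)
                    mdist (c (nth (domR c) (domL c :: s) i))
                          (c (nth (domR c) (domL c :: s) i.+1)))%:E
            | s in itv_partition (domL c) (domR c)].

Definition increasing_homeo (a b a' b' : R) (h : R -> R) : Prop :=
  exists g : R -> R,
    [/\ set_fun `[a, b] `[a', b'] h /\ set_fun `[a', b'] `[a, b] g,
        {in `[a, b], cancel h g} /\ {in `[a', b'], cancel g h},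
        {within `[a, b], continuous h} /\
          {within `[a', b'], continuous g} &
        {in `[a, b] &, {homo h : x y / x <= y}}].

Definition frechet c1 c2 : Prop :=
  exists2 h : R -> R,
    increasing_homeo (domL c1) (domR c1) (domL c2) (domR c2) h &
    {in `[domL c1, domR c1], c1 =1 c2 \o h}.

Definition fixed_endpoint_homotopy (a b : R) (f g : R -> X)
    (H : R * R -> X) : Prop :=
  [/\ {within `[a, b] `*` `[0, 1], continuous H},
      {in `[a, b], forall t, H (t, 0) = f t},
      {in `[a, b], forall t, H (t, 1) = g t} &
      {in `[0, 1], forall s, H (a, s) = f a /\ H (b, s) = f b}].

(* A path with degenerate domain is also represented by the constant paths on
   arbitrary intervals with the same value. *)
Definition represents c c' : Prop :=
  frechet c' c \/
  domL c = domR c /\ {in `[domL c', domR c'], forall t, c' t = c (domL c)}.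

Definition homotopic c1 c2 : Prop :=
  exists c1' c2' : cpath X,
    [/\ represents c1 c1', represents c2 c2',
        domL c1' = domL c2' /\ domR c1' = domR c2' &
        exists H, fixed_endpoint_homotopy (domL c1') (domR c1') c1' c2' H].

Definition normal_path c : Prop :=
  ~ exists u v : R,
      [/\ domL c <= u, u < v, v <= domR c, c u = c v &
          exists H, fixed_endpoint_homotopy u v c (cst (c u)) H].

End Paths.

(* Main.v *)
Require Import Defs.
From mathcomp Require Import lra zify.

(** A compact subset of a one-dimensional space has arbitrarily fine open covers
    in which no point lies in three members.  Recording the members met by a
    path along a fine grid turns the path into a word, and a homotopy with fixed
    end points changes this word only by free reduction, because a small
    triangle sees at most two labels.  The height of the stack that reduces the
    word of [f] on [[0, t]], measured with a gauge adapted to the modulus of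
    continuity of [f], has a limit [g t] along an ultrafilter of finer and finer
    covers and grids.  Then [f] factors through the R-tree coded by [g], and [g]
    takes equal values at the ends of every null-homotopic subpath.  Following
    [f] along the segment of the tree from its root to the end of the path gives
    the normal path.  For uniqueness, code the null-homotopic loop made of a
    normal path and the reverse of a homotopic one: by normality [g] strictly
    increases on the first half and strictly decreases on the second, so points
    of equal height match the two paths.  *)

Set Implicit Arguments.
Unset Strict Implicit.
Unset Printing Implicit Defensive.

Import Order.TTheory GRing.Theory Num.Theory.
Import numFieldNormedType.Exports.
Local Open Scope classical_set_scope.
Local Open Scope ring_scope.

(** * Free reduction of words *)

(** The obstacle is that reduced words get longer without bound as the covers shrink, and that words
    for different covers cannot be compared. So a stack is weighed by the largest sum of gauge
    values over its subsequences. The gauge of two letters is at most the time elapsed between their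
    readings, so such sums telescope, and heights are bounded and equicontinuous uniformly in cover
    and grid. On the other hand the gauge of letters that are far apart is bounded below, so the
    limit still separates the points of the path. As heights are plain numbers, an ultrafilter
    suffices for the limit and no maps between the trees of different covers are needed. The R-tree
    itself is never built: later arguments use only [g], its minima on subintervals, and
    [tree_coded]. The dimension enters through the labellings alone; for the inductive dimensions
    these need a cover built by hand from zero-dimensional frontiers. *)

Section Stacks.
Variable T : eqType.
Implicit Types (s : seq T) (x y z : T) (u v a : nat -> T).

(** Reduced stacks with a given bottom letter are the non-backtracking edge paths from it in the
    complete graph on the letters, that is, the vertices of the universal covering tree; [push]
    stays put or moves to a neighbour. *)
Definition push s x :=
  if s is y :: s' then
    if x == y then s else
    if s' is z :: _ then if x == z then s' else x :: s else x :: s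
  else [:: x].

Fixpoint reduced s :=
  if s is x :: s1 then
    (if s1 is y :: s2 then
      (x != y) && (if s2 is z :: _ then x != z else true) else true)
    && reduced s1
  else true.

Lemma push_top s x : exists s', push s x = x :: s'.
Proof.
case: s => [|y s] /=; first by exists [::].
have [->|_] := eqVneq x y; first by exists s.
case: s => [|z s]; first by exists [:: y].
by have [->|_] := eqVneq x z; eexists.
Qed.

Lemma push_head x s : push (x :: s) x = x :: s.
Proof. by rewrite /= eqxx. Qed.

Lemma push_reduced s x : reduced s -> reduced (push s x).
Proof.
case: s => [|y s] //= /andP[ys rs].
have [_|xy] := eqVneq x y; first by rewrite /= ys.
case: s ys rs => [|z s] ys rs; first by rewrite /= xy.
by have [//|xz] := eqVneq x z; rewrite /= xy xz; move: ys rs => /= -> ->.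
Qed.

(** The delicate case is a pop: the returning [y] must neither merge with nor cancel against the
    letters uncovered, and [reduced] excludes both. *)
Lemma pushK y s x : reduced (y :: s) -> push (push (y :: s) x) y = y :: s.
Proof.
move=> rs; rewrite {2}/push; have [_|xy] := eqVneq x y.
  exact: push_head.
case: s rs => [|z s] rs; first by rewrite /= eq_sym (negbTE xy) eqxx.
have [xz|xz] := eqVneq x z; last by rewrite /= eq_sym (negbTE xy) eqxx.
case: s rs => [|w s] /=; rewrite ?andbT -?andbA.
  by move=> yz; rewrite (negbTE yz).
by case/and5P => yz yw _ _ _; rewrite (negbTE yz) (negbTE yw).
Qed.

Definition degenerate3 x y z := [|| x == y, x == z | y == z].

Lemma push_tri y s x z : reduced (y :: s) -> degenerate3 y x z ->
  push (push (y :: s) x) z = push (y :: s) z.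
Proof.
move=> rs /or3P[/eqP<-|/eqP<-|/eqP->].
- by rewrite push_head.
- by rewrite pushK // push_head.
- by have [s' ->] := push_top (y :: s) z; rewrite push_head.
Qed.

Fixpoint stk s u n := if n is m.+1 then push (stk s u m) (u n) else s.

Lemma stk_reduced s u n : reduced s -> reduced (stk s u n).
Proof. by move=> rs; elim: n => //= n IH; exact: push_reduced. Qed.

Lemma stk_top s u n : (exists s', s = u 0%N :: s') ->
  exists s', stk s u n = u n :: s'.
Proof. by case: n => //= n _; exact: push_top. Qed.

Lemma stk_add s u i n :
  stk (stk s u i) (fun k => u (i + k)%N) n = stk s u (i + n).
Proof. by elim: n => [|n IH] /=; rewrite ?addn0 // addnS /= IH. Qed.

Lemma eq_stk s u v n : {in [pred k | (0 < k <= n)%N], u =1 v} ->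
  stk s u n = stk s v n.
Proof.
elim: n => //= n IH uv; rewrite IH; first by rewrite uv // inE /=.
by move=> k; rewrite inE => /andP[k0 kn]; rewrite uv // inE k0 ltnW.
Qed.

(** The strip between the words [u] and [v] is cut into degenerate triangles, two for each [k], and
    [push_tri] carries the stack across one after the other. *)
Lemma stk_row s u v n : reduced s -> (exists s', s = u 0%N :: s') ->
  (forall k, (k < n)%N -> degenerate3 (u k) (u k.+1) (v k.+1)) ->
  (forall k, (k < n)%N -> degenerate3 (u k) (v k) (v k.+1)) ->
  push (stk s u n) (v n) = stk (push s (v 0%N)) v n.
Proof.
move=> rs us; elim: n => //= n IH h1 h2.
rewrite -IH; first last.
- by move=> k kn; apply: h2; exact: ltnW.
- by move=> k kn; apply: h1; exact: ltnW.
have [s' e] := stk_top n us; have := stk_reduced u n rs; rewrite e => re.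
by rewrite !push_tri // ?h1 ?h2.
Qed.

Lemma stk_row_ends s u v n : reduced s -> (exists s', s = u 0%N :: s') ->
  u 0%N = v 0%N -> u n = v n ->
  (forall k, (k < n)%N -> degenerate3 (u k) (u k.+1) (v k.+1)) ->
  (forall k, (k < n)%N -> degenerate3 (u k) (v k) (v k.+1)) ->
  stk s u n = stk s v n.
Proof.
move=> rs us uv0 uvn h1 h2; have := stk_row rs us h1 h2.
have [s' e] := stk_top n us; rewrite -uvn e push_head => ->.
by case: us => t ->; rewrite -uv0 push_head.
Qed.

Lemma stk_cst s n x : (exists s', s = x :: s') -> stk s (fun=> x) n = s.
Proof. by case=> s' ->; elim: n => //= n ->; rewrite push_head. Qed.

End Stacks.

(** * Heights of stacks *)

Section Height.
Context {R : realType} {X : metricType R} (P : X -> X -> R).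
Hypothesis P_ge0 : forall x y, 0 <= P x y.
Hypothesis P_xx : forall x, P x x = 0.
Hypothesis P_sym : forall x y, P x y = P y x.
Hypothesis P_lip : forall x y z, P x z <= P y z + mdist x y.

(** The largest sum of [P] over consecutive letters of a subsequence of [x :: s] that starts with
    this [x]. Letters may be skipped because no triangle inequality is assumed for [P]: a direct
    jump can be worth more than its intermediate steps. *)
Fixpoint best x (s : seq X) : R :=
  if s is y :: s' then Num.max (best x s') (best y s' + P x y) else 0.

Definition height (s : seq X) : R := if s is x :: s' then best x s' else 0.

Lemma best_ge0 x s : 0 <= best x s.
Proof. by elim: s => //= y s IH; rewrite le_max IH. Qed.

Lemma height_ge0 s : 0 <= height s.
Proof. by case: s => //= x s; exact: best_ge0. Qed.

Lemma best_lip x y s : best x s <= best y s + mdist x y.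
Proof.
elim: s => [|z s IH] /=; first by rewrite add0r mdist_ge0.
rewrite addr_maxl ge_max !le_max; apply/andP; split; first by rewrite IH.
by apply/orP; right; rewrite -addrA lerD2l.
Qed.

Lemma best_cons x y s : best y s + P x y <= best x (y :: s).
Proof. by rewrite /= le_max lexx orbT. Qed.

Lemma best_cat x e y s : best y s + P x y <= best x (e ++ y :: s).
Proof.
by elim: e => [|z e IH] /=; rewrite le_max ?lexx ?IH ?orbT.
Qed.

Lemma P_le_mdist x y : P x y <= mdist x y.
Proof. by rewrite (le_trans (P_lip x y y)) // P_xx add0r. Qed.

(** Every case compares a stack with the same stack plus one letter on top, and that letter adds
    between [0] and its distance from the letter below. *)
Lemma height_push y s x :
  `|height (push (y :: s) x) - height (y :: s)| <= mdist x y.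
Proof.
have key z t w : best z t <= best w (z :: t) <= best z t + mdist w z.
  apply/andP; split.
    by rewrite (le_trans _ (best_cons _ _ _)) // lerDl.
  by rewrite ge_max best_lip lerD2l P_le_mdist.
rewrite /push; have [->|xy] := eqVneq x y.
  by rewrite subrr normr0 mdist_ge0.
case: s => [|z s].
  by have := key y [::] x; rewrite ler_norml /height; lra.
have [->|xz] := eqVneq x z; rewrite ler_norml.
  by have := key z s y; rewrite /height metric_sym; lra.
by have := key y (z :: s) x; rewrite /height; lra.
Qed.

Section Excursion.
Variables (m : nat) (S : nat -> seq X) (a : nat -> X) (t : nat -> R).
Hypothesis S_push : forall k, (k < m)%N -> S k.+1 = push (S k) (a k.+1).
Hypothesis S0_top : exists s', S 0%N = a 0%N :: s'.
Hypothesis S_size : forall k, (k <= m)%N -> (size (S 0%N) <= size (S k))%N.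
Hypothesis P_time : forall i j, (i <= j <= m)%N -> P (a i) (a j) <= t j - t i.

(** As long as [S 0] is not undercut it survives as the bottom of the stack, and above it a letter
    lies higher the later it was read. This order is what lets sums of [P] telescope through
    [P_time]. *)
Let excursion_indices k : (k <= m)%N ->
  exists2 J : seq nat, S k = [seq a j | j <- J] ++ S 0%N &
    path (fun i j => (i > j)%N) k.+1 J && all (leq 1) J.
Proof.
elim: k => [_|k IH km]; first by exists [::].
have {IH} [J SJ pJ] := IH (ltnW km).
have := S_size km; rewrite S_push // SJ.
have pk J' : path (fun i j => (i > j)%N) k.+1 J' -> path (fun i j => (i > j)%N) k.+2 J'.
  by case: J' => //= j J' /andP[jk ->]; rewrite (ltn_trans jk).
case/andP: pJ => pJ aJ.
have [s' S0E] := S0_top.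
case: J pJ aJ SJ => [|j J] pJ aJ SJ.
  rewrite S0E /=; case: eqVneq => [_ _|ne]; first by exists [::].
  case: s' S0E => [|z s'] S0E; first by exists [:: k.+1]; rewrite //= ltnSn.
  case: eqVneq => [_|_ _] /=; first by rewrite ltnn.
  by exists [:: k.+1]; rewrite //= ltnSn.
rewrite map_cons cat_cons /push; case: (eqVneq (a k.+1) (a j)) => [_ _|ne].
  by exists (j :: J); rewrite // pk.
have ext : exists2 J0 : seq nat,
    a k.+1 :: [seq a j | j <- j :: J] ++ S 0%N = [seq a j | j <- J0] ++ S 0%N &
    path (fun i j => (i > j)%N) k.+2 J0 && all (leq 1) J0.
  by exists (k.+1 :: j :: J) => //=; move: pJ aJ => /= -> ->; rewrite ltnSn.
case: J pJ aJ SJ ext => [|i J] pJ aJ SJ ext /=.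
  case: s' S0E => [|z s'] S0E; rewrite S0E.
    case: eqVneq => [_ _|_ _]; first by exists [::].
    by move: ext; rewrite S0E.
  case: eqVneq => [_ _|_ _]; first by exists [::].
  by move: ext; rewrite S0E.
case: eqVneq => [_ _|_ _]; last exact: ext.
exists (i :: J) => //; move: pJ aJ => /= /and3P[jk ij ->] /andP[_ ->].
by rewrite andbT (ltn_trans ij) // (ltn_trans jk).
Qed.

(** Jumps within the upper part and onto [a 0] telescope by [P_time]. [D] pays for a chain that
    skips [a 0]: its last letter above is replaced by [a 0] using [best_lip]. *)
Let best_excursion (D : R) s j J :
  path (fun i j => (i > j)%N) j J -> all (leq 1) (j :: J) -> (j <= m)%N ->
  (forall i, (i <= m)%N -> mdist (a i) (a 0%N) <= D) ->
  best (a j) ([seq a i | i <- J] ++ a 0%N :: s) <=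
  best (a 0%N) s + (t j - t 0%N) + D.
Proof.
move=> + + + aD; elim: J j => [|i J IH] j pJ aJ jm.
  have tj := P_time (i := 0) (j := j) jm.
  have Dj := aD _ jm; have D0 := aD _ (leq0n m).
  have b1 := best_lip (a j) (a 0%N) s.
  rewrite mdistxx in D0; have p0 := P_ge0 (a 0%N) (a j).
  rewrite /= ge_max P_sym; apply/andP; split; lra.
move: pJ aJ => /= /andP[ij pJ] /and3P[j0 i0 aJ].
have im : (i <= m)%N by apply: leq_trans (ltnW ij) jm.
have pJ' : path (fun i j => (i > j)%N) j J.
  by case: (J) pJ => //= k K /andP[ki ->]; rewrite (ltn_trans ki).
rewrite ge_max IH //= ?j0 //=.
have := IH i pJ; rewrite /= i0 aJ => /(_ isT im).
have tij : P (a i) (a j) <= t j - t i by apply: P_time; rewrite (ltnW ij).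
rewrite [P (a j) _]P_sym; lra.
Qed.

Lemma height_excursion_ge : height (S 0%N) + P (a m) (a 0%N) <= height (S m).
Proof.
have [J SJ _] := excursion_indices (leqnn m).
have top : exists s', S m = a m :: s'.
  by case: (m) S_push => [|k] Sp //; rewrite Sp //; exact: push_top.
have [s' S0E] := S0_top; rewrite SJ S0E /=.
case: J SJ => [|j J] SJ /=.
  case: top => s1; rewrite SJ S0E => -[<- _].
  by rewrite P_xx addr0.
case: top => s1; rewrite SJ => -[-> _]; exact: best_cat.
Qed.

Lemma height_excursion_le D :
  (forall i, (i <= m)%N -> mdist (a i) (a 0%N) <= D) ->
  height (S m) <= height (S 0%N) + (t m - t 0%N) + D.
Proof.
move=> aD; have [J SJ] := excursion_indices (leqnn m).
have [s' S0E] := S0_top; rewrite SJ S0E /=.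
have tm k : (k <= m)%N -> 0 <= t m - t k.
  by move=> km; rewrite (le_trans _ (P_time _)) // km leqnn.
have t0 := tm _ (leq0n m).
have D0 := aD _ (leq0n m); rewrite mdistxx in D0.
case: J SJ => [|j J] SJ /=; first by move=> _; lra.
move=> /andP[/andP[jm pJ] aJ].
have := best_excursion s' pJ aJ jm aD; have := tm _ jm; lra.
Qed.

End Excursion.

(** Take for [p] a time in [[i, j]] at which the stack is shortest. Its stack is a common bottom
    part of all stacks in between, so the run from [p] forwards to [j] and the run from [p]
    backwards to [i] are both excursions. *)
Lemma height_valley (a : nat -> X) (t : nat -> R) i j : (i <= j)%N ->
  (forall i j, (i <= j)%N -> P (a i) (a j) <= t j - t i) ->
  let g k := height (stk [:: a 0%N] a k) in
  exists p, [/\ (i <= p <= j)%N,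
    g p + P (a i) (a p) <= g i /\ g p + P (a j) (a p) <= g j &
    forall D, (forall k, (i <= k <= j)%N -> mdist (a k) (a p) <= D) ->
      g i <= g p + (t p - t i) + D /\ g j <= g p + (t j - t p) + D].
Proof.
move=> ij Pt g; pose S := stk [:: a 0%N] a.
have top k : exists s', S k = a k :: s' by apply: stk_top; exists [::].
have red k : reduced (S k) by exact: stk_reduced.
have [p /andP[ip pj] pmin] : exists2 p, (i <= p <= j)%N &
    forall k, (i <= k <= j)%N -> (size (S p) <= size (S k))%N.
  pose Q n := [exists k : 'I_j.+1, (i <= k)%N && (size (S k) == n)].
  have exQ : exists n, Q n.
    by exists (size (S j)); apply/existsP; exists ord_max; rewrite ij eqxx.
  case: (ex_minnP exQ) => n /existsP[p /andP[ip /eqP pn]] nmin.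
  exists p; first by rewrite ip -ltnS ltn_ord.
  move=> k /andP[ik kj]; rewrite pn; apply: nmin; apply/existsP.
  by exists (Ordinal (kj : (k < j.+1)%N)); rewrite /= ik eqxx.
exists p.
(* Running the word backwards from [p] is again a run of the stack machine,
   because [push] is undone by pushing the previous letter. *)
have back k : (k < p - i)%N -> S (p - k.+1)%N = push (S (p - k)%N) (a (p - k.+1)%N).
  move=> kp; have -> : (p - k = (p - k.+1).+1)%N by lia.
  have [s' e] := top (p - k.+1)%N; have := red (p - k.+1)%N.
  by rewrite /S /= -/S e => rs; rewrite pushK.
have forw k : (k < j - p)%N -> S (p + k.+1)%N = push (S (p + k)%N) (a (p + k.+1)%N).
  by move=> _; rewrite addnS.
have bsz k : (k <= p - i)%N -> (size (S (p - 0)) <= size (S (p - k)))%N.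
  by move=> kp; rewrite subn0; apply: pmin; lia.
have fsz k : (k <= j - p)%N -> (size (S (p + 0)) <= size (S (p + k)))%N.
  by move=> kp; rewrite addn0; apply: pmin; lia.
have btop : exists s', S (p - 0)%N = a (p - 0)%N :: s' by exact: top.
have ftop : exists s', S (p + 0)%N = a (p + 0)%N :: s' by exact: top.
(* Along the backward run time is counted as [- t], so that it increases. *)
have bP k l : (k <= l <= p - i)%N ->
    P (a (p - k)%N) (a (p - l)%N) <= - t (p - l)%N - - t (p - k)%N.
  move=> kl; rewrite P_sym opprK addrC; apply: Pt; lia.
have fP k l : (k <= l <= j - p)%N ->
    P (a (p + k)%N) (a (p + l)%N) <= t (p + l)%N - t (p + k)%N.
  move=> kl; apply: Pt; lia.
have epi : (p - (p - i) = i)%N by lia.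
have epj : (p + (j - p) = j)%N by lia.
split; first by rewrite ip.
- split.
  + by have := @height_excursion_ge _ _ (fun k => a (p - k)%N) back btop bsz; rewrite epi subn0.
  + by have := @height_excursion_ge _ _ (fun k => a (p + k)%N) forw ftop fsz; rewrite epj addn0.
- move=> D aD; split.
  + have := @height_excursion_le _ _ (fun k => a (p - k)%N) (fun k => - t (p - k)%N) back btop bsz bP D.
    rewrite epi subn0 opprK [- _ + _]addrC; apply.
    by move=> k kp; apply: aD; lia.
  + have := @height_excursion_le _ _ (fun k => a (p + k)%N) (fun k => t (p + k)%N) forw ftop fsz fP D.
    rewrite epj addn0; apply.
    by move=> k kp; apply: aD; lia.
Qed.

End Height.

(** * Labellings of compact sets *)

(** A Lebesgue number argument: locally one radius serves all nearby points, and the covering form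
    of compactness, applied to the filter of small positive radii, makes it global. *)
Lemma compact_uniform (R : realType) (T : pseudoMetricType R) (C : set T)
    (Q : R -> T -> Prop) : compact C ->
  (forall r r' x, 0 < r' -> r' <= r -> Q r x -> Q r' x) ->
  (forall x, C x -> exists2 r, 0 < r & forall y, C y -> ball x r y -> Q r y) ->
  exists2 r, 0 < r & forall x, C x -> Q r x.
Proof.
move=> /compact_near_coveringP/near_covering_withinP cC Qle Qloc.
have [|r [r0 rQ]] := @filter_ex _ (0 : R)^'+ _ (fun r => 0 < r /\ C `<=` Q r).
  near=> r; split; first by near: r; exact: nbhs_right_gt.
  near: r; apply: cC => x Cx; have [r r0 rQ] := Qloc _ Cx.
  near=> y s => /= Cy; apply: (@Qle r).
  - by near: s; exact: nbhs_right_gt.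
  - by near: s; exact: nbhs_right_le.
  - by apply: rQ => //; near: y; exact: nbhsx_ballx.
by exists r.
Unshelve. all: by end_near. Qed.

(* [compact_cover] of the library requires a pointed space. *)
Lemma compact_subcover (T : topologicalType) (C : set T) (U : T -> set T) :
  compact C -> (forall x, C x -> open (U x)) -> (forall x, C x -> U x x) ->
  exists s : seq T, forall x, C x -> exists2 z, z \in s & U z x.
Proof.
move=> /compact_near_coveringP/near_covering_withinP cC Uo Uxx.
pose F : set_system (seq T) :=
  [set A | exists s : seq T, forall s' : seq T, {subset s <= s'} -> A s'].
have FF : Filter F.
  split; first by exists [::].
    move=> A B [s sA] [s' s'B]; exists (s ++ s') => t st; split.
      by apply: sA => x xs; apply: st; rewrite mem_cat xs.
    by apply: s'B => x xs; apply: st; rewrite mem_cat xs orbT.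
  by move=> A B AB [s sA]; exists s => t /sA /AB.
have [|s sC] := cC _ F (fun s x => exists2 z, z \in s & U z x) FF.
  move=> x Cx; exists (U x, [set s | x \in s]) => /=.
    split; first by apply: open_nbhs_nbhs; split; [exact: Uo|exact: Uxx].
    by exists [:: x] => s; apply; rewrite inE.
  by case=> y s /= [xy xs] _; exists x.
by exists s => x; exact: sC.
Qed.

Section Labels.
Context {R : realType} {X : metricType R}.
Implicit Types (C S F : set X) (x y z : X) (e r : R).

Lemma ball_mdist x e y : ball x e y = (mdist x y < e) :> Prop.
Proof. by rewrite ballEmdist. Qed.

(** Labels are points of [X] rather than members of a cover, so that distances between letters make
    sense. The second clause is the trace of dimension one. *)
Definition labelling C e r (V : X -> X) :=
  (forall x, C x -> mdist (V x) x < e) /\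
  (forall x y z, C x -> C y -> C z ->
    mdist x y < r -> mdist x z < r -> mdist y z < r ->
    degenerate3 (V x) (V y) (V z)).

Definition labelled C :=
  forall e, 0 < e -> exists2 r, 0 < r & exists V, labelling C e r V.

Lemma labelling_of_cover C e (U : set (set X)) : compact C ->
  (forall V, U V -> open V) -> (forall x, C x -> exists2 V, U V & V x) ->
  (forall V x y, U V -> V x -> V y -> C x -> C y -> mdist x y < e) ->
  (forall x V1 V2 V3, C x -> U V1 -> U V2 -> U V3 -> V1 x -> V2 x -> V3 x ->
    [\/ V1 = V2, V1 = V3 | V2 = V3]) ->
  exists2 r, 0 < r & exists V, labelling C e r V.
Proof.
move=> cC Uo Uc Ue Um.
have [|x Cx|r r0 rU] :=
  @compact_uniform _ X C (fun r x => exists2 V, U V & ball x r `<=` V) cC.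
- move=> r r' x r'0 rr' [V UV xV]; exists V => //.
  exact: subset_trans (le_ball rr') xV.
- have [V UV Vx] := Uc _ Cx.
  have /nbhs_ballP[r /= r0 rV] : nbhs x V by apply: open_nbhs_nbhs; split; [exact: Uo|].
  exists (r / 2) => [|y Cy xy]; first by rewrite divr_gt0.
  exists V => // z yz; apply: rV; apply: (le_ball _ (ball_triangle xy yz)).
  by lra.
exists r => //.
have /choice[W HW] : forall x, exists V, C x -> U V /\ ball x r `<=` V.
  move=> x; have [/rU[V UV xV]|nCx] := pselect (C x); first by exists V.
  by exists setT.
have [[x0 _]|C0] := pselect (exists x, C x); last first.
  exists id; split; first by move=> x Cx; case: C0; exists x.
  by move=> x y z Cx; case: C0; exists x.
(* The label depends on [x] only through the member [W x], so equal members give equal labels. For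
   three points close together all three members contain the first point, hence two of them
   coincide. *)
exists (fun x => xget x0 (W x `&` C)); split=> [x Cx|x y z Cx Cy Cz].
  have [UW xW] := HW _ Cx.
  have Wx : W x x by apply: xW; exact: ballxx.
  by case: xgetP => [y -> [Wy Cy]|/(_ x)[]//]; exact: Ue UW _ _ _ _.
rewrite -!ball_mdist => xy xz yz.
have [Ux xW] := HW _ Cx; have [Uy yW] := HW _ Cy; have [Uz zW] := HW _ Cz.
have [] := Um x _ _ _ Cx Ux Uy Uz.
- by apply: xW; exact: ballxx.
- by apply: yW; exact: ball_sym.
- by apply: zW; exact: ball_sym.
- by move=> ->; rewrite /degenerate3 eqxx.
- by move=> ->; rewrite /degenerate3 eqxx orbT.
- by move=> ->; rewrite /degenerate3 eqxx !orbT.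
Qed.

Lemma multiplicity_two (T : Type) (D : set (set T)) (x : T) V1 V2 V3 :
  multiplicity_le D 2 -> D V1 -> D V2 -> D V3 -> V1 x -> V2 x -> V3 x ->
  [\/ V1 = V2, V1 = V3 | V2 = V3].
Proof.
move=> /(_ x)/pcard_leP[f] D1 D2 D3 x1 x2 x3.
have m1 : V1 \in [set V | D V /\ V x] by rewrite inE.
have m2 : V2 \in [set V | D V /\ V x] by rewrite inE.
have m3 : V3 \in [set V | D V /\ V x] by rewrite inE.
have inj := @inj _ _ _ f.
have := @funS _ _ _ _ f _ (set_mem m1); have := @funS _ _ _ _ f _ (set_mem m2).
have := @funS _ _ _ _ f _ (set_mem m3) => /= l3 l2 l1.
have : [\/ f V1 = f V2, f V1 = f V3 | f V2 = f V3].
  case: (f V1) (f V2) (f V3) l1 l2 l3 => [|[|?]] [|[|?]] [|[|?]] //= _ _ _;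
    by [constructor 1|constructor 2|constructor 3].
by case=> /inj h; [constructor 1|constructor 2|constructor 3]; exact: h.
Qed.

Lemma labelled_of_refinement C : compact C ->
  (forall e, 0 < e -> exists D : set (set X),
    [/\ open_cover D, refines D [set ball x e | x in [set: X]] &
      multiplicity_le D 2]) -> labelled C.
Proof.
move=> cC H e e0; have [|D [[Do Dc] Dr Dm]] := H (e / 2); first by rewrite divr_gt0.
apply: (@labelling_of_cover _ _ D) => //.
- move=> x _; have : (\bigcup_(V in D) V) x by rewrite Dc.
  by case=> V DV Vx; exists V.
- move=> V x y DV Vx Vy _ _; have [_ [z _ <-] Vz] := Dr _ DV.
  have := Vz _ Vx; have := Vz _ Vy; rewrite !ball_mdist => zy zx.
  by have := metric_triangle x z y; rewrite (metric_sym x z); lra.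
- by move=> x V1 V2 V3 _; exact: multiplicity_two.
Qed.

Lemma open_cover_balls e : 0 < e ->
  open_cover [set ball x e | x in [set: X]].
Proof.
move=> e0; split; last first.
  rewrite -subTset => x _; exists (ball x e); first by exists x.
  exact: ballxx.
move=> _ [x _ <-]; rewrite openE => y; rewrite ball_mdist => xy.
apply/nbhs_ballP; exists (e - mdist x y) => /=; first by rewrite subr_gt0.
move=> z; rewrite !ball_mdist => yz; have := metric_triangle x y z; lra.
Qed.

Lemma labelled_cdim C : compact C -> cdim_lt 2 X -> labelled C.
Proof.
move=> cC dX; apply: labelled_of_refinement => // e e0.
exact/dX/open_cover_balls.
Qed.

Lemma labelled_udim C : compact C -> udim_lt 2 X -> labelled C.
Proof.
move=> cC dX; apply: labelled_of_refinement => // e e0.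
have [|D [[Do _] Dr Dm]] := dX [set ball x e | x in [set: X]].
  split; first exact: open_cover_balls.
  by exists e => // V; exists V.
by exists D.
Qed.

(** * Inductive dimensions: chains and zero-dimensional compact sets *)

Inductive chain S r x : X -> Prop :=
| chain0 : S x -> chain S r x x
| chainS y z : chain S r x y -> S z -> mdist y z < r -> chain S r x z.

Lemma chain_memr S r x y : chain S r x y -> S y.
Proof. by case. Qed.

Lemma chain_meml S r x y : chain S r x y -> S x.
Proof. by elim. Qed.

Lemma chain_le S r r' x y : r <= r' -> chain S r x y -> chain S r' x y.
Proof.
move=> rr'; elim=> [Sx|y' z _ IH Sz yz]; first exact: chain0.
exact: chainS IH Sz (lt_le_trans yz rr').
Qed.

Lemma chain_trans S r x y z : chain S r x y -> chain S r y z -> chain S r x z.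
Proof. by move=> xy; elim=> // z' w _ IH Sw zw; exact: chainS IH Sw zw. Qed.

Lemma chain1 S r x y : S x -> S y -> mdist x y < r -> chain S r x y.
Proof. by move=> Sx Sy; apply: chainS => //; exact: chain0. Qed.

Lemma chain_sym S r x y : chain S r x y -> chain S r y x.
Proof.
elim=> [Sx|y' z xy IH Sz yz]; first exact: chain0.
by apply: chain_trans IH; apply: chain1; rewrite 1?metric_sym //; exact: chain_memr xy.
Qed.

(** A uniform form of dimension zero. It holds for compact sets with small relatively clopen
    neighbourhoods, and it passes to finite unions by an elementary argument, in place of a sum
    theorem. *)
Definition chain_disconnected S :=
  forall e, 0 < e -> exists2 r, 0 < r & forall x y, chain S r x y -> mdist x y < e.

Lemma chain_disconnected_ub S e b : chain_disconnected S -> 0 < e -> 0 < b ->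
  exists r, [/\ 0 < r, r <= b & forall x y, chain S r x y -> mdist x y < e].
Proof.
move=> dS e0 b0; have [r r0 H] := dS _ e0.
exists (Num.min r b); split; rewrite ?lt_min ?r0 ?ge_min ?lexx ?orbT //.
by move=> x y xy; apply: H; apply: chain_le xy; rewrite ge_min lexx.
Qed.

(* Along a chain in [S1 `|` S2] with fine enough steps, the excursions into
   [S2] are so short that the visited points of [S1] still form a chain. *)
Lemma chain_disconnectedU S1 S2 :
  chain_disconnected S1 -> chain_disconnected S2 ->
  chain_disconnected (S1 `|` S2).
Proof.
move=> d1 d2 e e0.
have [|r1 r10 H1] := d1 (e / 4); first by rewrite divr_gt0.
(* An excursion into [S2] costs two steps shorter than [r] and a chain of diameter less than [b]. As
   [r <= b <= r1 / 3], the points of [S1] before and after it are less than [r1] apart. *)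
pose b := Num.min (e / 8) (r1 / 3).
have b0 : 0 < b by rewrite lt_min !divr_gt0.
have [be br] : b <= e / 8 /\ b <= r1 / 3 by rewrite !ge_min !lexx orbT.
have [r [r0 rb H2]] := chain_disconnected_ub d2 b0 b0.
exists r => // x y xy.
have inv : chain S2 r x y \/ exists p q, [/\ mdist x p < b + r,
    chain S1 r1 p q & q = y \/ exists2 w, mdist q w < r & chain S2 r w y].
  elim: xy => [[Sx|Sx]|y' z _ IH Sz yz].
  - right; exists x, x; split; [by rewrite mdistxx addr_gt0|exact: chain0|by left].
  - by left; exact: chain0.
  case: IH => [xy|[p [q [xp pq qy]]]].
    case: Sz => Sz; last by left; exact: chainS xy Sz yz.
    right; exists z, z; split; [|exact: chain0|by left].
    have := H2 _ _ xy; have := metric_triangle x y' z; lra.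
  right; exists p; case: Sz => Sz; last first.
    exists q; split=> //; right.
    case: qy => [->|[w qw wy]]; last by exists w => //; exact: chainS wy Sz yz.
    by exists z => //; exact: chain0.
  exists z; split => //; last by left.
  apply: chainS pq Sz _; case: qy => [->|[w qw wy]]; first by lra.
  have := H2 _ _ wy; have := metric_triangle q w z.
  have := metric_triangle w y' z; lra.
case: inv => [/H2|[p [q [xp /H1 pq qy]]]]; first lra.
have qy' : mdist q y < r + b.
  case: qy => [->|[w qw /H2 wy]]; first by rewrite mdistxx addr_gt0.
  by have := metric_triangle q w y; lra.
have := metric_triangle x p y; have := metric_triangle p q y; lra.
Qed.

Definition relatively_clopen F (W : set X) :=
  forall y, F y -> exists2 r, 0 < r &
    forall z, F z -> mdist y z < r -> (W z <-> W y).

(** Compactness gives an [r] such that no step shorter than [r] enters or leaves the clopen set [W];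
    a chain starting close to the centre of [W] therefore stays in it. *)
Lemma chain_disconnected_clopen S : compact S ->
  (forall x e, S x -> 0 < e -> exists W, [/\ W x,
    (forall y, S y -> W y -> mdist x y < e) & relatively_clopen S W]) ->
  chain_disconnected S.
Proof.
move=> cS H e e0.
suff [r r0 rS] : exists2 r, 0 < r &
    forall x, S x -> forall y, chain S r x y -> mdist x y < e.
  by exists r => // x y xy; apply: rS (chain_meml xy) _ xy.
apply: compact_uniform => //.
  by move=> r r' x _ rr' h y xy; apply: h; exact: chain_le xy.
move=> x Sx; have [|W [Wx We Wc]] := H x (e / 2) Sx; first by rewrite divr_gt0.
have [|y Sy|r r0 rW] := @compact_uniform _ X S (fun r y => forall z, S z ->
    mdist y z < r -> (W z <-> W y)) cS.
- by move=> r r' y _ rr' h z Sz yz; apply: h => //; exact: lt_le_trans rr'.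
- have [r r0 rW] := Wc _ Sy; exists (r / 2); first by rewrite divr_gt0.
  move=> z Sz; rewrite ball_mdist => yz w Sw zw.
  have := metric_triangle y z w => ?; rewrite !rW //; lra.
exists r => // y Sy; rewrite ball_mdist => xy z yz.
have Wy : W y by apply/(rW x).
have Wz : W z by elim: yz => // z1 z2 c1 W1 S2 d12; apply/(rW z1) => //; exact: chain_memr c1.
have := We _ Sy Wy; have := We _ (chain_memr yz) Wz.
by have := metric_triangle y x z; rewrite (metric_sym y x); lra.
Qed.

(** A set with empty frontier in the subspace [F] is clopen there. [F] will be the frontier of a set
    in [X], about which [ind_lt] speaks, and intersecting with [S] makes it compact. *)
Lemma small_clopen_subset S F : ind_lt 1 (set_type F) ->
  forall x e, (S `&` F) x -> 0 < e -> exists W, [/\ W x,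
    (forall y, (S `&` F) y -> W y -> mdist x y < e) & relatively_clopen (S `&` F) W].
Proof.
move=> dF x e [_ Fx] e0.
have nbhs_sub (y : set_type F) (V : set X) :
    nbhs (val y) V -> nbhs y (val @^-1` V).
  exact: (@initial_continuous (set_type F) X set_val y).
have nbhs_subP (y : set_type F) (V : set (set_type F)) : nbhs y V ->
    exists2 r, 0 < r & forall z : set_type F, mdist (val y) (val z) < r -> V z.
  rewrite nbhsE => -[V' [[A Ao AV'] V'y] V'V].
  have /nbhs_ballP[r r0 rA] : nbhs (val y) A.
    by apply: open_nbhs_nbhs; split => //; move: V'y; rewrite -AV'.
  exists r => // z yz; apply: V'V; rewrite -AV'; apply: rA.
  by rewrite ball_mdist.
pose x' : set_type F := SigSub (mem_set Fx).
have [|U [Uo Ux UV /= fU]] := dF x' (val @^-1` (ball x e)).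
  by apply: nbhs_sub; exact: nbhsx_ballx.
have clU (y : set_type F) : closure U y -> U y.
  move=> cUy; have [/interior_subset//|nUy] := pselect (U° y).
  have fy : frontier U y by split.
  by have : [set: set_type (frontier U)] (SigSub (mem_set fy)) by []; rewrite fU.
exists (val @` U); split.
- by exists x'.
- move=> _ _ [y Uy <-]; have := UV _ Uy; by rewrite /= ball_mdist.
- move=> y [_ Fy]; pose y' : set_type F := SigSub (mem_set Fy).
  have valU z (Fz : F z) : (val @` U) z <-> U (SigSub (mem_set Fz)).
    split=> [[w Uw wz]|Uz]; last by exists (SigSub (mem_set Fz)).
    by have -> : SigSub (mem_set Fz) = w by exact: val_inj.
  have [Uy|nUy] := pselect (U y').
    have [|r r0 rU] := nbhs_subP y' U; first exact: open_nbhs_nbhs.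
    exists r => // z [_ Fz] yz; rewrite (valU _ Fz) (valU _ Fy).
    by split=> // _; apply: rU.
  have [|r r0 rU] := nbhs_subP y' (~` U).
    apply: contrapT => nV; apply: nUy; apply: clU => B By.
    apply: contrapT => UB; apply: nV; apply: filterS By => w Bw Uw.
    by apply: UB; exists w.
  exists r => // z [_ Fz] yz; rewrite (valU _ Fz) (valU _ Fy); split=> // Uz.
  by case: (rU (SigSub (mem_set Fz)) yz Uz).
Qed.

Lemma closed_frontier (U : set X) : closed (frontier U).
Proof. by apply: closedI; [exact: closed_closure|exact/open_closedC/open_interior]. Qed.

(** The cover consists of two families: the sets [W i], members of a finite cover minus the closures
    of the earlier ones, and the sets [O b], thin neighbourhoods of the chain components of the
    frontiers. Distinct sets of one family are disjoint, so a point lies in at most two members. *)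
Lemma labelled_ind C : compact C -> ind_lt 2 X -> labelled C.
Proof.
move=> cC dX e e0.
have /choice[U HU] : forall x : X, exists U : set X,
    [/\ open U, U x, U `<=` ball x (e / 2) & ind_lt 1 (set_type (frontier U))].
  by move=> x; apply: dX; apply: nbhsx_ballx; rewrite divr_gt0.
have [||s0 Cs0] := @compact_subcover _ C U cC.
- by move=> x _; have [] := HU x.
- by move=> x _; have [] := HU x.
have [s Cs] : exists s : seq X, forall x, C x ->
    exists2 i, (i < size s)%N & U (nth x s i) x.
  exists s0 => x /Cs0[z zs Uz]; exists (index z s0); first by rewrite index_mem.
  by rewrite nth_index.
(* [nth] needs a default point and [X] may be empty, so the default is taken from the list
   itself. *)
pose V i : set X := if s is x0 :: _ then U (nth x0 s i) else set0.
have Cs' x : C x -> exists2 i, (i < size s)%N & V i x.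
  move=> /Cs[i si Ui]; exists i => //; rewrite /V.
  by case: (s) si Ui => // x0 t si; rewrite (set_nth_default x0).
have Vo i : open (V i).
  by rewrite /V; case: (s) => [|x0 t]; [exact: open0|have [] := HU (nth x0 (x0 :: t) i)].
have Ve i x y : V i x -> V i y -> mdist x y < e.
  rewrite /V; case: (s) => // x0 t.
  have [_ _ h _] := HU (nth x0 (x0 :: t) i); move=> /h + /h; rewrite !ball_mdist.
  move: (nth _ _ _) => z zx zy; have := metric_triangle x z y.
  by rewrite (metric_sym x z); lra.
have Vd i : chain_disconnected (C `&` frontier (V i)).
  apply: chain_disconnected_clopen.
    by apply: compact_closedI cC _; exact: closed_frontier.
  have [[x0 x0s]|] := pselect (exists x0 : X, s = x0 :: behead s).
    apply: small_clopen_subset.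
    by rewrite /V x0s; have [] := HU (nth x0 (x0 :: behead s) i).
  move=> sE x r [_]; rewrite /V; case: (s) sE => [_|x0 t sE].
    by rewrite /frontier closure0 => -[].
  by case: sE; exists x0.
pose B n := [set x | C x /\ exists2 i, (i < n)%N & frontier (V i) x].
have Bd : chain_disconnected (B (size s)).
  elim: (size s) => [|n IH].
    by move=> r r0; exists 1 => // x y /chain_meml[_ []].
  have -> : B n.+1 = B n `|` (C `&` frontier (V n)).
    apply/seteqP; split=> x.
      case=> Cx [i]; rewrite ltnS leq_eqVlt => /predU1P[->|ni] fx; first by right.
      by left; split => //; exists i.
    case=> [[Cx [i ni fx]]|[Cx fx]]; split=> //; last by exists n.
    by exists i => //; exact: ltnW.
  exact: chain_disconnectedU.
have [||r [r0 re Hr]] := chain_disconnected_ub (e := e / 8) (b := e / 8) Bd;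
  rewrite ?divr_gt0 //.
(* Points of the frontiers whose [r / 3]-neighbourhoods meet are less than [r] apart, hence in the
   same chain component: two sets [O b] are equal or disjoint. *)
pose O b := [set y | exists2 b', chain (B (size s)) r b b' & mdist b' y < r / 3].
pose W i := V i `&` \bigcap_(j in [set j | (j < i)%N]) ~` closure (V j).
have Osym b c y : O b y -> O c y -> O b `<=` O c.
  move=> [b1 bb1 b1y] [c1 cc1 c1y] z [b2 bb2 b2z]; exists b2 => //.
  apply: (chain_trans cc1); apply: chain_trans (chain_trans (chain_sym bb1) bb2).
  apply: chain1; [exact: chain_memr cc1|exact: chain_memr bb1|].
  by have := metric_triangle c1 y b1; rewrite (metric_sym y b1); lra.
have Wdisj i j y : W i y -> W j y -> i = j.
  wlog ij : i j / (i < j)%N => [hw Wi Wj|[Viy _] [_ Wj]].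
    by have [ij|ji|//] := ltngtP i j; [exact: hw|symmetry; exact: hw].
  by case: (Wj i ij); exact: subset_closure.
apply: (@labelling_of_cover _ _
  [set A | (exists b, A = O b) \/ exists i, A = W i]) => //.
- move=> A [[b ->]|[i ->]].
    rewrite openE => y [b' bb' b'y]; apply/nbhs_ballP.
    exists (r / 3 - mdist b' y) => /=; first by rewrite subr_gt0.
    move=> z; rewrite ball_mdist => yz; exists b' => //.
    by have := metric_triangle b' y z; lra.
  apply: openI => //.
  have -> : \bigcap_(j in [set j | (j < i)%N]) ~` closure (V j) =
            ~` \bigcup_(j in `I_i) closure (V j) by rewrite setC_bigcup.
  apply: closed_openC; apply: closed_bigcup => // j _; exact: closed_closure.
- move=> x Cx.
  have [[i si fx]|nfx] := pselect (exists2 i, (i < size s)%N & frontier (V i) x).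
    exists (O x); first by left; exists x.
    exists x; first by apply: chain0; split => //; exists i.
    by rewrite mdistxx divr_gt0.
  (* Take the first [V i] whose closure contains [x]; as [x] lies on no frontier, it lies in [V i]
     itself, hence in [W i]. *)
  have exi : exists i, (i < size s)%N && `[< closure (V i) x >].
    have [i si Vx] := Cs' _ Cx; exists i; rewrite si; apply/asboolP.
    exact: subset_closure.
  case: (ex_minnP exi) => i /andP[si /asboolP clx] imin.
  exists (W i); first by right; exists i.
  split.
    have [/interior_subset//|nVx] := pselect ((V i)° x).
    by case: nfx; exists i.
  move=> j /= ji clj; have := imin j; rewrite (ltn_trans ji si) /=.
  by move=> /(_ (asboolT clj)); rewrite leqNgt ji.
- move=> A x y [[b ->]|[i ->]]; last by move=> [Vx _] [Vy _] _ _; exact: Ve Vx Vy.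
  move=> [b1 /Hr bb1 b1x] [b2 /Hr bb2 b2y] _ _.
  have := metric_triangle x b1 y; have := metric_triangle b1 b y.
  have := metric_triangle b b2 y; rewrite (metric_sym x b1) (metric_sym b1 b); lra.
- move=> x V1 V2 V3 _.
  have OO b c : O b x -> O c x -> O b = O c.
    by move=> bx cx; apply/seteqP; split; [exact: Osym bx cx|exact: Osym cx bx].
  have WW i j : W i x -> W j x -> W i = W j by move=> ix jx; rewrite (Wdisj _ _ _ ix jx).
  move=> [[b1 ->]|[i1 ->]] [[b2 ->]|[i2 ->]] [[b3 ->]|[i3 ->]] h1 h2 h3;
    by [constructor 1; auto|constructor 2; auto|constructor 3; auto].
Qed.

End Labels.

(** The large inductive condition is applied to singletons; these remain closed in the frontier, so
    the induction continues. *)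
Lemma Ind_ind n (T : topologicalType) : (forall x : T, closed [set x]) ->
  Ind_lt n T -> ind_lt n T.
Proof.
elim: n T => //= n IH T T1 dT x V Vx.
have [|U [Uo xU UV dU]] := dT [set x] V° (T1 x) (open_interior V).
  by move=> _ ->.
exists U; split; [by []|exact: xU|exact: subset_trans UV (@interior_subset _ V)|].
apply: IH dU => y; rewrite -openC.
exists (~` [set val y]); first by rewrite openC.
apply/seteqP; split=> z /= zy; first by move=> zy'; apply: zy; rewrite zy'.
by move=> zy'; apply: zy; exact: val_inj.
Qed.

Lemma labelled_one_dimensional (R : realType) (X : metricType R) (C : set X) :
  one_dimensional X -> compact C -> labelled C.
Proof.
move=> + cC; case=> -[dX _].
- exact: labelled_ind.
- apply: labelled_ind => //; apply: Ind_ind dX => x.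
  exact/accessible_closed_set1/hausdorff_accessible/metric_hausdorff.
- exact: labelled_cdim.
- exact: labelled_udim.
Qed.

(** * The height function of a path *)

Section Clamp.
Context {R : realType}.
Implicit Types a b x y : R.

Definition clamp a b x := Num.max a (Num.min b x).

Lemma clamp_in a b x : a <= b -> a <= clamp a b x <= b.
Proof. by move=> ab; rewrite le_max lexx ge_max ab ge_min lexx. Qed.

Lemma clamp_id a b x : a <= x <= b -> clamp a b x = x.
Proof. by case/andP=> ax xb; rewrite /clamp (min_idPr xb) (max_idPr ax). Qed.

Lemma clamp_lel a b x : a <= b -> x <= a -> clamp a b x = a.
Proof.
by move=> ab xa; rewrite /clamp (min_idPr (le_trans xa ab)) (max_idPl xa).
Qed.

Lemma clamp_ler a b x : a <= b -> b <= x -> clamp a b x = b.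
Proof. by move=> ab bx; rewrite /clamp (min_idPl bx) (max_idPr ab). Qed.

Lemma clamp00 : clamp 0 1 0 = 0 :> R. Proof. exact: clamp_lel. Qed.

Lemma clamp11 : clamp 0 1 1 = 1 :> R. Proof. exact: clamp_ler. Qed.

Lemma clamp_lip a b x y : `|clamp a b x - clamp a b y| <= `|x - y|.
Proof.
have mx (c u v : R) : `|Num.max c u - Num.max c v| <= `|u - v|.
  have [cu|uc] := lerP u c; have [cv|vc] := lerP v c => //.
  - by rewrite subrr normr0.
  - by rewrite distrC ger0_norm ?(distrC u) ?ger0_norm; lra.
  - by rewrite !ger0_norm; lra.
have mn (c u v : R) : `|Num.min c u - Num.min c v| <= `|u - v|.
  have [cu|uc] := lerP c u; have [cv|vc] := lerP c v => //.
  - by rewrite subrr normr0.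
  - by rewrite !ger0_norm; lra.
  - by rewrite distrC ger0_norm ?(distrC u) ?ger0_norm; lra.
exact: le_trans (mx _ _ _) (mn _ _ _).
Qed.

End Clamp.

Section HeightFunction.
Context {R : realType} {X : metricType R}.
Implicit Types (C : set X) (e r s t u : R).

(** Paths and homotopies are handled as total functions, extended outside their domain with [clamp],
    so that uniform continuity on the line or plane replaces continuity on a compact set. *)
Definition ucont (f : R -> X) := forall e, 0 < e -> exists2 d, 0 < d &
  forall x y, `|x - y| < d -> mdist (f x) (f y) < e.

Definition ucont2 (H : R -> R -> X) := forall e, 0 < e -> exists2 d, 0 < d &
  forall x y x' y', `|x - x'| < d -> `|y - y'| < d ->
    mdist (H x y) (H x' y') < e.

Definition ucontR (g : R -> R) := forall e, 0 < e -> exists2 d, 0 < d &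
  forall x y, `|x - y| < d -> `|g x - g y| < e.

(* [g] is the distance to the root in an R-tree through which [f] factors. *)
Definition tree_coded (f : R -> X) (g : R -> R) :=
  forall e, 0 < e -> exists2 k, 0 < k & forall s t, 0 <= s -> s <= t -> t <= 1 ->
    (forall u, s <= u <= t -> g s - k < g u /\ g t - k < g u) ->
    mdist (f s) (f t) < e.

Definition homotopy (p q : R) (f f' : R -> X) (H : R -> R -> X) :=
  [/\ ucont2 H, forall t, p <= t <= q -> H t 0 = f t,
      forall t, p <= t <= q -> H t 1 = f' t &
      forall s, 0 <= s <= 1 -> H p s = f p /\ H q s = f q].

Definition nullhomotopy (p q : R) (f : R -> X) := homotopy p q f (fun=> f p).

Lemma nullhomotopy_loop p q f H : p <= q -> nullhomotopy p q f H -> f q = f p.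
Proof.
move=> pq [_ _ H1 Hpq].
have [_ <-] : H p 1 = f p /\ H q 1 = f q by apply: Hpq; rewrite lexx ler01.
by rewrite H1 // lexx pq.
Qed.

Section Modulus.
Variables (f : R -> X).
Hypothesis fu : ucont f.

Let psi_set (d : R) : set R := [set x : R | exists s t : R, x = `|s - t| + `|d - mdist (f s) (f t)|].

(* The largest 1-Lipschitz function with [psi (mdist (f s) (f t)) <= |s - t|]. *)
Definition psi (d : R) : R := inf (psi_set d).

Let psi_set0 d : psi_set d !=set0.
Proof. by exists (`|(0 : R) - 0| + `|d - mdist (f 0) (f 0)|), 0, 0. Qed.

Let psi_lb d : lbound (psi_set d) 0.
Proof. by move=> _ [s [t ->]]; rewrite addr_ge0. Qed.

Lemma psi_ge0 d : 0 <= psi d.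
Proof. exact: lb_le_inf. Qed.

Lemma psi_le d s t : psi d <= `|s - t| + `|d - mdist (f s) (f t)|.
Proof. by apply: ge_inf; [exists 0; exact: psi_lb|exists s, t]. Qed.

Lemma psi_lip d d' : psi d <= psi d' + `|d - d'|.
Proof.
rewrite -lerBlDr; apply: lb_le_inf => // _ [s [t ->]].
rewrite lerBlDr (le_trans (psi_le d s t)) // -addrA lerD2l addrC.
exact: ler_distD.
Qed.

Lemma psi_xx : psi 0 = 0.
Proof.
apply/eqP; rewrite eq_le psi_ge0 andbT (le_trans (psi_le 0 0 0)) //.
by rewrite mdistxx !subrr normr0 addr0.
Qed.

(** In the infimum that defines [psi], either [|s - t|] is at least [d], or [f s] and [f t] are
    closer than [e / 2] and the second summand is at least [e / 2]. *)
Lemma psi_gt0 e : 0 < e -> exists2 k, 0 < k & forall d, e <= d -> k <= psi d.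
Proof.
move=> e0; have [|d d0 fd] := fu (e := e / 2); first by rewrite divr_gt0.
exists (Num.min d (e / 2)) => [|x ex]; first by rewrite lt_min d0 divr_gt0.
apply: lb_le_inf => // _ [s [t ->]]; rewrite ge_min.
have [dst|/fd dst] := lerP d `|s - t|.
  by rewrite (le_trans dst) // lerDl.
apply/orP; right; rewrite (@le_trans _ _ `|x - mdist (f s) (f t)|) ?lerDr //.
by rewrite (le_trans _ (ler_norm _)) //; lra.
Qed.

(* Subtracting [2 e] absorbs the errors of an [e]-labelling. *)
Definition gauge e (x y : X) := Num.max 0 (psi (mdist x y) - 2 * e).

Lemma gauge_ge0 e x y : 0 <= gauge e x y.
Proof. by rewrite le_max lexx. Qed.

Lemma gauge_ge e x y : psi (mdist x y) - 2 * e <= gauge e x y.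
Proof. by rewrite le_max lexx orbT. Qed.

Lemma gauge_xx e x : 0 < e -> gauge e x x = 0.
Proof.
by move=> e0; apply/max_idPl; rewrite mdistxx psi_xx; lra.
Qed.

Lemma gauge_sym e x y : gauge e x y = gauge e y x.
Proof. by rewrite /gauge metric_sym. Qed.

Lemma gauge_lip e x y z : gauge e x z <= gauge e y z + mdist x y.
Proof.
have g0 := gauge_ge0 e y z; have d0 := mdist_ge0 x y; have gg := gauge_ge e y z.
rewrite ge_max; apply/andP; split; first lra.
have := psi_lip (mdist x z) (mdist y z).
suff : `|mdist x z - mdist y z| <= mdist x y by lra.
have := metric_triangle x y z; have := metric_triangle y x z.
by rewrite (metric_sym y x) ler_norml; lra.
Qed.

(** This supplies the bound by elapsed time that [height_valley] requires. *)
Lemma gauge_label e (x y : X) s t : mdist x (f s) < e -> mdist y (f t) < e -> s <= t ->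
  gauge e x y <= t - s.
Proof.
move=> xs yt st; rewrite ge_max subr_ge0 st /= lerBlDr.
have := psi_le (mdist x y) s t; rewrite distrC ger0_norm ?subr_ge0 //.
suff : `|mdist x y - mdist (f s) (f t)| <= 2 * e by lra.
have := metric_triangle x (f s) y; have := metric_triangle (f s) (f t) y.
have := metric_triangle (f s) x (f t); have := metric_triangle x y (f t).
rewrite (metric_sym (f s) x) (metric_sym (f t) y) ler_norml; lra.
Qed.

End Modulus.

(** * The limit of the heights along an ultrafilter *)

Section Limit.
Variables (C : set X) (f : R -> X).
Hypotheses (cC : compact C) (lC : labelled C) (fu : ucont f).
Hypothesis fC : forall t, C (f t).

Let err n : R := n.+1%:R^-1.

Let err_gt0 n : 0 < err n. Proof. by rewrite invr_gt0. Qed.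

Let err_small d : 0 < d -> exists n0, forall n, (n0 <= n)%N -> err n < d.
Proof.
move=> d0; exists (Num.truncn d^-1).+1 => n nn.
rewrite invf_plt ?posrE ?invr_gt0 ?ltr0n //.
by rewrite (lt_le_trans (truncnS_gt _)) // ler_nat leqW.
Qed.

Let scales : {rV : nat -> R * (X -> X) | forall n,
  0 < (rV n).1 /\ labelling C (err n) (rV n).1 (rV n).2}.
Proof.
have h n : {rV : R * (X -> X) | 0 < rV.1 /\ labelling C (err n) rV.1 rV.2}.
  apply: cid; have [r r0 [V HV]] := lC (err_gt0 n); by exists (r, V).
by exists (fun n => sval (h n)) => n; exact: (svalP (h n)).
Qed.

Let rad n := (sval scales n).1.
Let lab n := (sval scales n).2.

Let rad_gt0 n : 0 < rad n. Proof. by have [] := svalP scales n. Qed.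

Let lab_close n x : C x -> mdist (lab n x) x < err n.
Proof. by have [_ [h _]] := svalP scales n; exact: h. Qed.

Let lab_deg n x y z : C x -> C y -> C z ->
  mdist x y < rad n -> mdist x z < rad n -> mdist y z < rad n ->
  degenerate3 (lab n x) (lab n y) (lab n z).
Proof. by have [_ [_ h]] := svalP scales n; exact: h. Qed.

Let time N k : R := k%:R * err N.
Let idx N t : nat := Num.truncn (t * N.+1%:R).

Let time_le N i j : (i <= j)%N -> time N i <= time N j.
Proof. by move=> ij; rewrite ler_pM2r // ler_nat. Qed.

Let timeS N k : time N k.+1 = time N k + err N.
Proof. by rewrite /time -addn1 natrD mulrDl mul1r. Qed.

Let time_ge0 N k : 0 <= time N k.
Proof. by rewrite mulr_ge0 // ltW. Qed.

Let time_idx N t : 0 <= t -> time N (idx N t) <= t < time N (idx N t) + err N.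
Proof.
move=> t0; rewrite -timeS /time /err ler_pdivrMr ?ltr_pdivlMr ?ltr0n //.
by apply: truncn_itv; rewrite mulr_ge0.
Qed.

Let idx_time N k : idx N (time N k) = k.
Proof. by rewrite /idx /time -mulrA mulVf ?mulr1 ?natrK ?pnatr_eq0. Qed.

Let idx_le N s t : s <= t -> (idx N s <= idx N t)%N.
Proof. by move=> st; apply: le_truncn; rewrite ler_wpM2r. Qed.

Let word n N k := lab n (f (time N k)).
Let gg n N t :=
  height (gauge f (err n)) (stk [:: word n N 0] (word n N) (idx N t)).

Let gg_ge0 n N t : 0 <= gg n N t. Proof. exact: height_ge0. Qed.

Let gg0 n N : gg n N 0 = 0.
Proof. by rewrite /gg /idx mul0r truncn0. Qed.

(** [height_valley] in continuous time. Since [idx] rounds down, the valley may precede [s] by up to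
    [err N]; the term [2 * err n] is the price for measuring oscillation by [f] instead of by
    labels. *)
Let valley n N s t : 0 <= s -> s <= t -> exists u, [/\ 0 <= u, s - err N <= u <= t,
  gg n N u + gauge f (err n) (word n N (idx N s)) (lab n (f u)) <= gg n N s,
  gg n N u + gauge f (err n) (word n N (idx N t)) (lab n (f u)) <= gg n N t &
  forall D, (forall x y, s - err N <= x <= t -> s - err N <= y <= t ->
      mdist (f x) (f y) <= D) ->
    gg n N s <= gg n N u + (t - s + err N) + D + 2 * err n /\
    gg n N t <= gg n N u + (t - s + err N) + D + 2 * err n].
Proof.
move=> s0 st; have t0 := le_trans s0 st.
have wt i j : (i <= j)%N ->
    gauge f (err n) (word n N i) (word n N j) <= time N j - time N i.
  by move=> ij; apply: gauge_label; rewrite ?lab_close ?time_le.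
have [p [/andP[ip pj] [ps pt] pD]] := height_valley (gauge_ge0 f (err n))
  (fun x => gauge_xx f x (err_gt0 n)) (gauge_sym f (err n))
  (gauge_lip f (err n)) (idx_le N st) wt.
have := time_idx N s0; have := time_idx N t0; have := time_le N ip.
have := time_le N pj => pj' ip' /andP[tt1 tt2] /andP[ts1 ts2].
exists (time N p); split.
- exact: time_ge0.
- lra.
- by rewrite {1}/gg idx_time.
- by rewrite {1}/gg idx_time.
- move=> D fD; have [|] := pD (D + 2 * err n).
    move=> k /andP[ik kj].
    have := time_le N ik; have := time_le N kj => kj' ik'.
    have d1 : mdist (f (time N k)) (f (time N p)) <= D by apply: fD; lra.
    have := lab_close n (fC (time N k)); have := lab_close n (fC (time N p)).
    have := metric_triangle (word n N k) (f (time N k)) (word n N p).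
    have := metric_triangle (f (time N k)) (f (time N p)) (word n N p).
    by rewrite (metric_sym (f (time N p)) (word n N p)) /word; lra.
  by move=> h1 h2; rewrite /gg idx_time; split; lra.
Qed.

(** Both heights exceed the height at the valley by an amount that is small uniformly in the cover
    and the grid. This makes the limit continuous. *)
Let equi e : 0 < e -> exists2 d, 0 < d & forall n N s t, err n < d ->
  err N < d -> 0 <= s -> 0 <= t -> `|s - t| < d -> `|gg n N s - gg n N t| < e.
Proof.
move=> e0; have [|d d0 fd] := fu (e := e / 8); first by rewrite divr_gt0.
pose b := Num.min (d / 2) (e / 16).
have b0 : 0 < b by rewrite lt_min !divr_gt0.
have [bd be] : b <= d / 2 /\ b <= e / 16 by rewrite !ge_min !lexx orbT.
exists b => // n N s t nb Nb.
wlog st : s t / s <= t.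
  move=> hw s0 t0 std; have [st|/ltW ts] := lerP s t; first exact: hw.
  by rewrite distrC; apply: hw; rewrite // distrC.
move=> s0 t0; rewrite distrC ger0_norm ?subr_ge0 // => std.
have [u [u0 su us ut uD]] := valley n N s0 st.
have [|h1 h2] := uD (e / 8).
  move=> x y x1 y1; apply/ltW/fd; rewrite ltr_norml; lra.
have := gauge_ge0 f (err n) (word n N (idx N s)) (lab n (f u)).
have := gauge_ge0 f (err n) (word n N (idx N t)) (lab n (f u)).
rewrite ltr_norml; lra.
Qed.

(** The grid index [N] may depend on the cover index [n], because the grid has to be fine compared
    with the radius [rad n]. *)
Let base : set_system (nat * nat) := [set A | exists n0, forall n, (n0 <= n)%N ->
  exists N0, forall N, (N0 <= N)%N -> A (n, N)].

Let base_proper : ProperFilter base.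
Proof.
split; first by case=> n0 /(_ _ (leqnn n0))[N0 /(_ _ (leqnn N0))].
split.
- by exists 0%N => n _; exists 0%N.
- move=> A B [a ha] [b hb]; exists (maxn a b) => n; rewrite geq_max => /andP[an bn].
  have [a' ha'] := ha _ an; have [b' hb'] := hb _ bn.
  by exists (maxn a' b') => N; rewrite geq_max => /andP[/ha' + /hb'].
- move=> A B AB [a ha]; exists a => n /ha[a' ha']; exists a' => N /ha'; exact: AB.
Qed.

Let ultra : {U : set_system (nat * nat) | UltraFilter U /\ base `<=` U}.
Proof. by apply: cid; exact: ultraFilterLemma. Qed.

Let U := sval ultra.
Let UU : UltraFilter U. Proof. by have [] := svalP ultra. Qed.
Let UP : ProperFilter U. Proof. exact: ultra_proper. Qed.
#[local] Existing Instance UP.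
Let baseU A : base A -> U A. Proof. by have [_] := svalP ultra; apply. Qed.

Let U_small d : 0 < d -> U [set i | err i.1 < d /\ err i.2 < d].
Proof.
move=> /err_small[n0 h]; apply: baseU; exists n0 => n nn; exists n0 => N NN.
by split; exact: h.
Qed.

Let gg_bounded : exists M, forall t, 0 <= t <= 1 -> U [set i | gg i.1 i.2 t <= M].
Proof.
(* Boundedness of [C] is put into the form of [compact_uniform] by writing the bound as [r^-1]. *)
have [|x Cx|r r0 rD] := @compact_uniform _ _ C (fun r x => mdist (f 0) x <= r^-1) cC.
- move=> r r' x r'0 rr' /le_trans; apply.
  by rewrite lef_pV2 // posrE (lt_le_trans r'0).
- have m0 := mdist_ge0 (f 0) x; have v0 : 0 < (mdist (f 0) x + 1)^-1 by rewrite invr_gt0; lra.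
  exists (Num.min 1 (mdist (f 0) x + 1)^-1); first by rewrite lt_min ltr01.
  move=> y Cy; rewrite ball_mdist lt_min => /andP[xy _].
  rewrite (@le_trans _ _ (mdist (f 0) x + 1)) //.
    by have := metric_triangle (f 0) x y; lra.
  rewrite -[leLHS]invrK lef_pV2 ?posrE // ?ge_min ?lexx ?orbT //.
  by rewrite lt_min ltr01.
(* [2 * r^-1] bounds the oscillation of [f], and [4] bounds [t + err N + 2 * err n]. *)
exists (2 * r^-1 + 4) => t /andP[t0 t1].
apply: filterS (U_small (ltr01 : 0 < (1 : R))) => -[n N] /= [n1 N1].
have [u [u0 _ h0 _ uD]] := valley n N (lexx 0) t0.
have [|_] := uD (2 * r^-1).
  move=> x y _ _; have := metric_triangle (f x) (f 0) (f y).
  have := rD _ (fC x); have := rD _ (fC y); rewrite (metric_sym (f x) (f 0)); lra.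
have := gauge_ge0 f (err n) (word n N (idx N 0)) (lab n (f u)).
rewrite gg0 in h0; lra.
Qed.

(** The ultrafilter limit of the heights, written as a supremum. That it is a limit rests on the
    dichotomy between a set and its complement in an ultrafilter. *)
Let g t := sup [set x | U [set i | x <= gg i.1 i.2 t]].

Let g_lim t e : 0 <= t <= 1 -> 0 < e ->
  U [set i | `|gg i.1 i.2 t - g t| < e].
Proof.
move=> t01 e0; have [M HM] := gg_bounded; have {HM}Mt := HM _ t01.
pose S := [set x | U [set i | x <= gg i.1 i.2 t]].
have S0 : S 0.
  by rewrite /S /=; apply: filterS (filterT : U setT) => i _; exact: gg_ge0.
have Sub : ubound S M.
  move=> x Sx; rewrite leNgt; apply/negP => Mx.
  have [i [/= h1 h2]] := filter_ex (filterI Mt Sx); lra.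
have hS : has_sup S by split; [exists 0|exists M].
have lo : U [set i | g t - e < gg i.1 i.2 t].
  have [x Sx xg] := sup_adherent e0 hS.
  apply: filterS Sx => i /= xi; exact: lt_le_trans xg xi.
have hi : U [set i | gg i.1 i.2 t < g t + e].
  have [] := in_ultra_setVsetC [set i | g t + e <= gg i.1 i.2 t] UU.
    move=> h; have := sup_upper_bound hS h; rewrite -/(g t); lra.
  by apply: filterS => i /= /negP; rewrite -ltNge.
apply: filterS (filterI lo hi) => i /= [h1 h2]; rewrite ltr_norml; lra.
Qed.

Let g_ucont e : 0 < e -> exists2 d, 0 < d & forall s t, 0 <= s <= 1 -> 0 <= t <= 1 ->
  `|s - t| < d -> `|g s - g t| < e.
Proof.
move=> e0; have e4 : 0 < e / 4 by rewrite divr_gt0.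
have [d d0 hd] := equi e4; exists d => // s t s01 t01 st.
have [[n N] /= [[h1 h2] [h3 h4]]] :=
  filter_ex (filterI (filterI (g_lim s01 e4) (g_lim t01 e4)) (U_small d0)).
have := hd n N s t h3 h4 (proj1 (andP s01)) (proj1 (andP t01)) st.
move: h1 h2; rewrite !ltr_norml; lra.
Qed.

(** Equicontinuity reduces the claim to finitely many grid times, and a filter is closed under
    finite intersections. *)
Let g_unif e : 0 < e ->
  U [set i | forall t, 0 <= t <= 1 -> `|gg i.1 i.2 t - g t| < e].
Proof.
move=> e0; have e4 : 0 < e / 4 by rewrite divr_gt0.
have [d d0 hd] := equi e4; have [d' d'0 hd'] := g_ucont e4.
have [|m0 /(_ _ (leqnn m0)) hm] := @err_small (Num.min d d').
  by rewrite lt_min d0.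
have fin j : U [set i | forall k, (k < j)%N -> time m0 k <= 1 ->
    `|gg i.1 i.2 (time m0 k) - g (time m0 k)| < e / 4].
  elim: j => [|j IH]; first by apply: filterS (filterT : U setT).
  have [tj|tj] := lerP (time m0 j) 1; last first.
    apply: filterS IH => i /= h k; rewrite ltnS leq_eqVlt => /predU1P[->|]; last exact: h.
    by rewrite leNgt tj.
  have tj' : 0 <= time m0 j <= 1 by rewrite time_ge0.
  apply: filterS (filterI IH (g_lim tj' e4)) => i /= [h1 h2] k.
  by rewrite ltnS leq_eqVlt => /predU1P[->//|]; exact: h1.
apply: filterS (filterI (fin m0.+2) (U_small d0)) => -[n N] /= [h [nd Nd]] t t01.
have /andP[t0 t1] := t01.
have /andP[k1 k2] := time_idx m0 t0.
have kt : (idx m0 t < m0.+2)%N.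
  rewrite ltnS -(ler_nat R); move: k1; rewrite /time /err.
  rewrite ler_pdivrMr ?ltr0n // => /le_trans; apply.
  by rewrite -[leRHS]mul1r ler_wpM2r.
have tk : `|t - time m0 (idx m0 t)| < err m0 by rewrite ltr_norml; lra.
move: hm; rewrite lt_min => /andP[md md'].
have := h _ kt (le_trans k1 t1).
have := hd n N _ _ nd Nd t0 (time_ge0 m0 (idx m0 t)) (lt_trans tk md).
have kt01 : 0 <= time m0 (idx m0 t) <= 1 by rewrite time_ge0 (le_trans k1).
have := hd' _ _ t01 kt01 (lt_trans tk md').
rewrite !ltr_norml; lra.
Qed.

(** If [g] never dips far below its end values, the height at the valley [u] is not much smaller
    either, so both gauges towards [u] are small. By [psi_gt0] the labels at [s] and [t] are then
    close to the label of [f u], hence to each other. *)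
Let g_tree : tree_coded f g.
Proof.
move=> e e0; have e8 : 0 < e / 8 by rewrite divr_gt0.
have [K K0 hK] := psi_gt0 fu e8.
have K8 : 0 < K / 8 by rewrite divr_gt0.
have [d1 d10 hd1] := equi K8; have [d2 d20 hd2] := fu e8.
pose b := Num.min (Num.min d1 d2) (Num.min (e / 16) (K / 16)).
have b0 : 0 < b by rewrite !lt_min d10 d20 !divr_gt0.
have [bd1 bd2 be bK] : [/\ b <= d1, b <= d2, b <= e / 16 & b <= K / 16].
  by rewrite !ge_min !lexx !orbT.
have [[n N] /= [hu [nb Nb]]] := filter_ex (filterI (g_unif K8) (U_small b0)).
have close x y : gauge f (err n) x y < K - 2 * err n -> mdist x y < e / 8.
  have := gauge_ge f (err n) x y => g1 g2.
  by rewrite ltNge; apply/negP => /hK; lra.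
have near x : 0 <= x -> mdist (f x) (word n N (idx N x)) < e / 8 + e / 16.
  move=> x0; have := time_idx N x0 => /andP[x1 x2].
  have := lab_close n (fC (time N (idx N x))).
  have : mdist (f x) (f (time N (idx N x))) < e / 8.
    by apply: hd2; rewrite ltr_norml; lra.
  have := metric_triangle (f x) (f (time N (idx N x))) (word n N (idx N x)).
  by rewrite (metric_sym (f (time _ _)) (word _ _ _)) /word; lra.
exists (K / 4) => [|s t s0 st t1 gst]; first by rewrite divr_gt0.
have t0 := le_trans s0 st; have s1 := le_trans st t1.
have [u [u0 /andP[su ut] us us' _]] := valley n N s0 st.
(* The valley may lie slightly before [s], where nothing is known about [g]; [u'] moves it into
   [[s, t]]. *)
pose u' := Num.max s u.
have u'st : s <= u' <= t by rewrite le_max lexx ge_max st.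
have u'u : `|u - u'| < d1.
  rewrite /u'; case: (lerP u s) => h; last by rewrite subrr normr0.
  by rewrite ltr_norml; lra.
have [gs gt] := gst _ u'st; have /andP[u's u't] := u'st.
have s01 : 0 <= s <= 1 by rewrite s0. have t01 : 0 <= t <= 1 by rewrite t0.
have u'01 : 0 <= u' <= 1 by rewrite (le_trans s0) ?(le_trans u't).
have := hd1 n N u u' (lt_le_trans nb bd1) (lt_le_trans Nb bd1) u0 (proj1 (andP u'01)) u'u.
have := hu _ s01; have := hu _ t01; have := hu _ u'01; rewrite !ltr_norml => h1 h2 h3 h4.
have c1 : mdist (word n N (idx N s)) (lab n (f u)) < e / 8 by apply: close; lra.
have c2 : mdist (word n N (idx N t)) (lab n (f u)) < e / 8 by apply: close; lra.
have := near _ s0; have := near _ t0.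
have := metric_triangle (f s) (word n N (idx N s)) (f t).
have := metric_triangle (word n N (idx N s)) (lab n (f u)) (f t).
have := metric_triangle (lab n (f u)) (word n N (idx N t)) (f t).
rewrite (metric_sym (lab n (f u)) (word _ _ _)) (metric_sym (word n N (idx N t)) (f t)); lra.
Qed.

(** The labels of the null-homotopy form rows that begin and end with the label of [f p];
    neighbouring rows give the same stack, and the last row is constant. [(idx N q).+1] is the first
    grid time after [q]. Pushing the label of [f p] on both sides compensates for [p] and [q] not
    being grid times. *)
Let null_stack n N p q H : 0 <= p -> p <= q -> nullhomotopy p q f H ->
  (forall t s, C (H t s)) ->
  (forall x y, `|x - y| < 3 * err N -> mdist (f x) (f y) < rad n) ->
  (exists2 d, err N < d & forall x y x' y', `|x - x'| < d -> `|y - y'| < d ->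
    mdist (H x y) (H x' y') < rad n) ->
  let S := stk [:: word n N 0] (word n N) in
  push (S (idx N q).+1) (lab n (f p)) = push (S (idx N p)) (lab n (f p)).
Proof.
move=> p0 pq nH HC fd [d Nd Hd] S.
have fpq := nullhomotopy_loop pq nH; have [_ H0 H1 Hpq] := nH.
have q0 := le_trans p0 pq.
have /andP[ip1 ip2] := time_idx N p0; have /andP[iq1 iq2] := time_idx N q0.
have ij := idx_le N pq; set i := idx N p in ip1 ip2 ij *; set j := idx N q in iq1 iq2 ij *.
pose m := (j.+1 - i)%N; have ejm : (i + m = j.+1)%N by rewrite /m subnKC // leqW.
pose b := lab n (f p); have eN := err_gt0 N.
(* Clamping the grid times makes the rows start exactly at [p] and end exactly at [q], where the
   homotopy is fixed. *)
pose c l := clamp p q (time N (i + l)).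
have c0 : c 0%N = p by rewrite /c addn0 clamp_lel.
have cm : c m = q by rewrite /c ejm clamp_ler // timeS ltW.
have cpq l : p <= c l <= q by exact: clamp_in.
have cS l : `|c l - c l.+1| <= err N.
  rewrite (le_trans (clamp_lip _ _ _ _)) // addnS timeS opprD addNKr normrN.
  by rewrite gtr0_norm.
have ct l : (l <= m)%N -> `|c l - time N (i + l)| <= err N.
  move=> lm; rewrite /c; have [lp|lp] := lerP (time N (i + l)) p.
    rewrite clamp_lel // ger0_norm ?subr_ge0 //.
    by have := time_le N (leq_addr l i); lra.
  have [lq|lq] := lerP q (time N (i + l)).
    rewrite clamp_ler // distrC ger0_norm ?subr_ge0 //.
    have /(time_le N) : (i + l <= j.+1)%N by rewrite -ejm leq_add2l.
    by rewrite timeS; lra.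
  by rewrite clamp_id ?subrr ?normr0 ?(ltW eN) // !ltW.
have Stop k : exists s' : seq X, S k = word n N k :: s' by apply: stk_top; exists [::].
have Sred k : reduced (S k) by exact: stk_reduced.
have [M0 /(_ _ (leqnn M0)) M0d] := err_small (lt_trans eN Nd).
pose row k l := lab n (H (c l) (time M0 k)).
have row0 l : row 0%N l = lab n (f (c l)) by rewrite /row /time mul0r H0.
have tM k : (k <= M0.+1)%N -> 0 <= time M0 k <= 1.
  move=> kM; rewrite time_ge0 /time /err ler_pdivrMr ?ltr0n // mul1r ler_nat //.
have row_l k : (k <= M0.+1)%N -> row k 0%N = b.
  by move=> /tM kM; rewrite /row c0 (Hpq _ kM).1.
have row_r k : (k <= M0.+1)%N -> row k m = b.
  by move=> /tM kM; rewrite /row cm (Hpq _ kM).2 fpq.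
have S'red : reduced (push (S i) b) by exact: push_reduced.
have S'top : exists s' : seq X, push (S i) b = b :: s' by exact: push_top.
have rowS k : (k <= M0)%N ->
    stk (push (S i) b) (row k) m = stk (push (S i) b) (row k.+1) m.
  move=> kM; have kM1 := leqW kM.
  have HH l l' y y' : (l' = l \/ l' = l.+1) -> (y' = y \/ y' = y.+1) ->
      mdist (H (c l) (time M0 y)) (H (c l') (time M0 y')) < rad n.
    move=> hl hy; apply: Hd.
      case: hl => ->; first by rewrite subrr normr0 (lt_trans eN).
      exact: le_lt_trans (cS l) Nd.
    case: hy => ->; first by rewrite subrr normr0 (lt_trans eN).
    by rewrite timeS opprD addNKr normrN gtr0_norm.
  apply: stk_row_ends => //; rewrite ?row_l ?row_r //.
  - move=> l _; apply: lab_deg => //; apply: HH; by [left|right].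
  - move=> l _; apply: lab_deg => //; apply: HH; by [left|right].
have rowM : stk (push (S i) b) (row M0.+1) m = push (S i) b.
  rewrite -[RHS](stk_cst m S'top); apply: eq_stk => l _; rewrite /row.
  have -> : time M0 M0.+1 = 1 by rewrite /time /err mulfV // pnatr_eq0.
  by rewrite H1.
have row_all k : (k <= M0.+1)%N -> stk (push (S i) b) (row 0%N) m =
    stk (push (S i) b) (row k) m.
  elim: k => [_|k IH kM]; first by [].
  exact: etrans (IH (ltnW kM)) (rowS k kM).
have SiE : stk (S i) (fun l => word n N (i + l)) m = S j.+1.
  by rewrite /S stk_add ejm.
have b0 : row 0%N 0%N = b by exact: row_l.
have bm : row 0%N m = b by exact: row_r.
(* One more strip joins the word of [f] at the grid times to row [0], which is taken at the clamped
   times. *)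
rewrite -/b -[RHS]rowM -row_all // -[X in push _ X]bm -SiE -[in RHS]b0.
apply: stk_row => //; first by rewrite addn0.
- move=> l lm; rewrite row0; apply: lab_deg => //; apply: fd.
  + rewrite addnS timeS opprD addNKr normrN gtr0_norm //; lra.
  + have := ct _ lm; rewrite addnS timeS ler_norml ltr_norml; lra.
  + have := ct _ lm; rewrite ler_norml ltr_norml; lra.
- move=> l lm; rewrite !row0; apply: lab_deg => //; apply: fd.
  + have := ct _ (ltnW lm); rewrite ler_norml ltr_norml; lra.
  + have := ct _ lm; rewrite addnS timeS ler_norml ltr_norml; lra.
  + have := cS l; rewrite ler_norml ltr_norml; lra.
Qed.

Let g_null p q H : 0 <= p -> p <= q -> q <= 1 -> nullhomotopy p q f H ->
  (forall t s, C (H t s)) -> g p = g q.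
Proof.
move=> p0 pq q1 nH HC; have q0 := le_trans p0 pq; have p1 := le_trans pq q1.
have [hH _ _ _] := nH; have fpq := nullhomotopy_loop pq nH.
apply: contrapT => /eqP; rewrite -subr_eq0 -normr_gt0 => gpq.
(* The losses add up to [11 * e]: three differences of heights of at most [3 * e] each, and two uses
   of [g_unif]. *)
pose e := `|g p - g q| / 20; have e0 : 0 < e by rewrite divr_gt0.
have fine : U [set i |
    (forall x y, `|x - y| < 3 * err i.2 -> mdist (f x) (f y) < Num.min (rad i.1) e) /\
    (exists2 d, err i.2 < d & forall x y x' y', `|x - x'| < d -> `|y - y'| < d ->
      mdist (H x y) (H x' y') < rad i.1)].
  apply: baseU; exists 0%N => n _.
  have [|d1 d10 h1] := fu (e := Num.min (rad n) e); first by rewrite lt_min rad_gt0.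
  have [d2 d20 h2] := hH _ (rad_gt0 n).
  have [|N0 hN] := @err_small (Num.min (d1 / 3) d2); first by rewrite lt_min divr_gt0.
  exists N0 => N /hN; rewrite lt_min => /andP[l1 l2]; split; last by exists d2.
  by move=> x y xy; apply: h1; lra.
have [[n N] /= [hu [[hf hd] [ne Ne]]]] :=
  filter_ex (filterI (g_unif e0) (filterI fine (U_small e0))).
have hfr x y : `|x - y| < 3 * err N -> mdist (f x) (f y) < rad n.
  by move=> /hf; rewrite lt_min => /andP[].
have hfe x y : `|x - y| < 3 * err N -> mdist (f x) (f y) < e.
  by move=> /hf; rewrite lt_min => /andP[].
have eN := err_gt0 N.
have /andP[ip1 ip2] := time_idx N p0; have /andP[iq1 iq2] := time_idx N q0.
have /= Spush := null_stack p0 pq nH HC hfr hd.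
pose S := stk [:: word n N 0] (word n N).
have hp k : `|height (gauge f (err n)) (push (S k) (lab n (f p))) -
    height (gauge f (err n)) (S k)| <= mdist (lab n (f p)) (word n N k).
  have [s' ->] : exists s' : seq X, S k = word n N k :: s' by apply: stk_top; exists [::].
  apply: height_push; [exact: gauge_ge0| |exact: gauge_lip].
  by move=> x; exact: gauge_xx.
have hS k : `|height (gauge f (err n)) (S k.+1) - height (gauge f (err n)) (S k)| <=
    mdist (word n N k.+1) (word n N k).
  rewrite {1}/S /= -/S.
  have [s' ->] : exists s' : seq X, S k = word n N k :: s' by apply: stk_top; exists [::].
  apply: height_push; [exact: gauge_ge0| |exact: gauge_lip].
  by move=> x; exact: gauge_xx.
have lw x k : mdist (f x) (f (time N k)) < e ->
    mdist (lab n (f x)) (word n N k) < 3 * e.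
  move=> xk; have := lab_close n (fC x); have := lab_close n (fC (time N k)).
  have := metric_triangle (lab n (f x)) (f x) (word n N k).
  have := metric_triangle (f x) (f (time N k)) (word n N k).
  by rewrite (metric_sym (f (time N k)) (word n N k)) /word (metric_sym (f x) (lab n _)); lra.
have l1 : mdist (lab n (f p)) (word n N (idx N p)) < 3 * e.
  by apply: lw; apply: hfe; rewrite ltr_norml; lra.
have l2 : mdist (lab n (f p)) (word n N (idx N q).+1) < 3 * e.
  by apply: lw; rewrite -fpq; apply: hfe; rewrite timeS ltr_norml; lra.
have l3 : mdist (word n N (idx N q).+1) (word n N (idx N q)) < 3 * e.
  by apply: lw; apply: hfe; rewrite timeS ltr_norml; lra.
have := hp (idx N p); have := hp (idx N q).+1; have := hS (idx N q).
rewrite /S Spush -/S -/(gg n N p) -/(gg n N q).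
have p01 : 0 <= p <= 1 by rewrite p0. have q01 : 0 <= q <= 1 by rewrite q0.
have := hu _ p01; have := hu _ q01.
have : `|g p - g q| = 20 * e by rewrite /e; lra.
rewrite /gg -/S; set x1 := height _ (S _); set x2 := height _ _; set x3 := height _ _.
set x4 := height _ _.
move: x1 x2 x3 x4 => x1 x2 x3 x4 {hp hS Spush} ge.
rewrite !ler_norml !ltr_norml => b1 b2 b3 b4 b5.
have : `|g p - g q| <= 11 * e by rewrite ler_norml; lra.
by rewrite ge; lra.
Qed.

Theorem tree_coding : exists g', [/\ ucontR g', forall t, 0 <= g' t, g' 0 = 0,
  tree_coded f g' &
  forall p q H, 0 <= p -> p <= q -> q <= 1 -> nullhomotopy p q f H ->
    (forall t s, C (H t s)) -> g' p = g' q].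
Proof.
have c01 t : 0 <= clamp 0 1 t <= (1 : R) by exact: clamp_in.
have g0 t : 0 <= t <= 1 -> 0 <= g t.
  move=> t01; rewrite leNgt; apply/negP => gt.
  have gt' : 0 < - g t by rewrite oppr_gt0.
  have [i /=] := filter_ex (g_lim t01 gt').
  by have := gg_ge0 i.1 i.2 t; rewrite ltr_norml; lra.
exists (fun t => g (clamp 0 1 t)); split.
- move=> e /g_ucont[d d0 hd]; exists d => // x y xy.
  by apply: hd => //; exact: le_lt_trans (clamp_lip _ _ _ _) xy.
- by move=> t; exact: g0.
- rewrite clamp_id ?lexx ?ler01 //; apply/eqP; rewrite eq_le g0 ?lexx ?ler01 // andbT.
  rewrite leNgt; apply/negP => gt; have z01 : 0 <= (0 : R) <= 1 by apply/andP; split.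
  have [[n N] /=] := filter_ex (g_lim z01 gt); rewrite gg0 ltr_norml; lra.
- move=> e /g_tree[k k0 hk]; exists k => // s t s0 st t1 hst; apply: hk => // u /andP[su ut].
  have su01 : s <= u <= t by rewrite su.
  by have := hst u su01; do 3! (rewrite clamp_id; last by lra).
- move=> p q H p0 pq q1 nH HC; do 2! (rewrite clamp_id; last by lra).
  exact: g_null nH HC.
Qed.

End Limit.
End HeightFunction.

(** * Homotopies and the normal form *)

Section RealFunctions.
Context {R : realType}.
Implicit Types (g : R -> R) (s t u v x y e d : R).

Lemma min_lip x y (x' y' : R) d : `|x - x'| < d -> `|y - y'| < d ->
  `|Num.min x y - Num.min x' y'| < d.
Proof.
by rewrite !ltr_norml; case: (lerP x y) => h1; case: (lerP x' y') => h2; lra.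
Qed.

Lemma max_lip x y (x' y' : R) d : `|x - x'| < d -> `|y - y'| < d ->
  `|Num.max x y - Num.max x' y'| < d.
Proof.
by rewrite !ltr_norml; case: (lerP x y) => h1; case: (lerP x' y') => h2; lra.
Qed.

Lemma normM_le x y : 0 <= y <= 1 -> `|x * y| <= `|x|.
Proof. by case/andP=> y0 y1; rewrite normrM ler_piMr // ger0_norm. Qed.

Lemma ucontR_continuous g : ucontR g -> continuous g.
Proof.
move=> gu x; apply/cvgrPdist_lt => e /gu[d d0 hd]; near=> y.
apply: hd; near: y; exact: (@cvgr_dist_lt _ _ _ _ _ id x) d0.
Unshelve. all: by end_near. Qed.

Lemma first_hit g s v x : ucontR g -> s <= v -> g v <= x -> x <= g s ->
  exists q, [/\ s <= q <= v, g q = x, forall u, s <= u <= q -> x <= g u &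
    x = g s -> q = s].
Proof.
move=> gu sv gvx xgs; have [xs|xs] := eqVneq x (g s).
  exists s; split=> //; first by rewrite lexx.
  by move=> u us; have -> : u = s by lra.
pose S := [set y | s <= y <= v /\ g y <= x].
have Sv : S v by split; rewrite ?sv ?lexx.
have hS : has_inf S by split; [exists v|exists s => y [/andP[]]].
pose q := inf S.
have sq : s <= q by apply: lb_le_inf; [exists v|move=> y [/andP[]]].
have qv : q <= v by apply: ge_inf => //; exact: hS.2.
have qmin y : S y -> q <= y by move=> Sy; apply: ge_inf => //; exact: hS.2.
have gq1 : g q <= x.
  rewrite leNgt; apply/negP => gq; have [|d d0 hd] := gu (g q - x); first lra.
  have [y Sy yq] := inf_adherent d0 hS; have := qmin _ Sy => qy.
  have yd : `|y - q| < d by rewrite ger0_norm ?subr_ge0 //; rewrite -/q in yq; lra.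
  have := hd _ _ yd; case: Sy => _ gy; rewrite ltr_norml; lra.
have before u : s <= u -> u < q -> x < g u.
  move=> su uq; rewrite ltNge; apply/negP => gux.
  have /qmin : S u by split => //; lra.
  lra.
have gq2 : x <= g q.
  rewrite leNgt; apply/negP => gq; have [|d d0 hd] := gu (x - g q); first lra.
  have sq' : s < q.
    by rewrite lt_neqAle sq andbT; apply/eqP => sq'; move: gq; rewrite -sq'; lra.
  have [z [sz zq dz]] : exists z, [/\ s <= z, z < q & `|z - q| < d].
    exists (Num.max s (q - d / 2)).
    by rewrite ltr_norml; case: (lerP s (q - d / 2)) => h; split; lra.
  have := before _ sz zq; have := hd _ _ dz; rewrite ltr_norml; lra.
exists q; split => //.
- by rewrite sq.
- lra.
- move=> u /andP[su]; rewrite le_eqVlt => /predU1P[->//|uq].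
  exact/ltW/before.
- by move=> xs'; rewrite xs' eqxx in xs.
Qed.

Lemma last_hit g v t x : ucontR g -> v <= t -> g v <= x -> x <= g t ->
  exists q, [/\ v <= q <= t, g q = x, forall u, q <= u <= t -> x <= g u &
    x = g t -> q = t].
Proof.
move=> gu vt gvx xgt.
have gu' : ucontR (fun y => g (- y)).
  move=> e /gu[d d0 hd]; exists d => // y z yz; apply: hd.
  by rewrite -opprD normrN.
have [| | |q [sq gq qu qs]] := @first_hit _ (- t) (- v) x gu'.
- by rewrite lerN2.
- by rewrite opprK.
- by rewrite opprK.
exists (- q); split=> //.
- lra.
- by move=> u qut; rewrite -[u]opprK; apply: qu; lra.
- by move=> xt; rewrite qs ?opprK.
Qed.

(** Being nondecreasing in [t], it can serve as the pace at which the normal path is followed. *)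
Definition runmin g v t := inf [set g x | x in [set x | t <= x <= v]].

Lemma runminP g v t : ucontR g -> t <= v ->
  exists m, [/\ t <= m <= v, runmin g v t = g m &
    forall u, t <= u <= v -> g m <= g u].
Proof.
move=> gu tv; have [|m] := @EVT_min R g t v tv.
  exact/continuous_subspaceT/ucontR_continuous.
rewrite in_itv /= => mtv hm.
have hin u : t <= u <= v -> g m <= g u by move=> utv; apply: hm; rewrite in_itv.
exists m; split=> //; apply/eqP; rewrite eq_le; apply/andP; split.
  apply: ge_inf; last by exists m.
  by exists (g m) => _ [x xtv <-]; exact: hin.
by apply: lb_le_inf; [exists (g m), m|move=> _ [x xtv <-]; exact: hin].
Qed.

Lemma runmin_le g v t u : ucontR g -> t <= u <= v -> runmin g v t <= g u.
Proof.
move=> gu /andP[tu uv]; have [m [_ -> hm]] := runminP gu (le_trans tu uv).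
by apply: hm; rewrite tu.
Qed.

Lemma runmin_homo g v t t' : ucontR g -> t <= t' -> t' <= v ->
  runmin g v t <= runmin g v t'.
Proof.
move=> gu tt' tv; have [m [/andP[m1 m2] -> hm]] := runminP gu tv.
by apply: runmin_le => //; rewrite (le_trans tt').
Qed.

Lemma runmin_close g v e d : ucontR g -> 
  (forall x y, `|x - y| < d -> `|g x - g y| < e) ->
  forall t t', t <= v -> t' <= v -> `|t - t'| < d ->
  `|runmin g v t - runmin g v t'| < e.
Proof.
move=> gu hd t t'; wlog tt' : t t' / t <= t'.
  move=> hw tv t'v tt'; have [|/ltW] := lerP t t' => h; first exact: hw.
  by rewrite distrC hw // distrC.
move=> tv t'v ttd; have := hd t t ; rewrite !subrr !normr0 => e0.
have h1 := runmin_homo gu tt' t'v; rewrite distrC ger0_norm ?subr_ge0 //.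
have d0 : 0 < d by exact: le_lt_trans ttd.
have {}e0 := e0 d0; have [m [/andP[tm mv] rm hm]] := runminP gu tv.
have [t'm|mt'] := lerP t' m.
  have : runmin g v t' <= g m by apply: runmin_le; rewrite // t'm.
  lra.
have : runmin g v t' <= g t' by apply: runmin_le; rewrite // lexx.
have : `|g t' - g m| < e.
  by apply: hd; move: ttd; rewrite !ltr_norml; lra.
rewrite ltr_norml; lra.
Qed.

(** Suppose [g t <= g s] with [s < t], and let [m] be a minimum point on [[s, t]]. Either [s, t] is
    already a forbidden pair, or [m] and the last time before [s] at the level [g m] form one. *)
Lemma ucontR_strict_mono g w : ucontR g -> 0 <= w ->
  (forall t, 0 <= t <= w -> g 0 <= g t) ->
  (forall u v, 0 <= u -> u < v -> v <= w -> g u = g v ->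
    (forall x, u <= x <= v -> g u <= g x) -> False) ->
  forall s t, 0 <= s -> s < t -> t <= w -> g s < g t.
Proof.
move=> gu w0 g0 H s t s0 st tw; rewrite ltNge; apply/negP => gts.
have [m [/andP[sm mt] _ hm]] := runminP gu (ltW st).
have gmt : g m <= g t by apply: hm; rewrite lexx ltW.
have [gms|gms] := eqVneq (g m) (g s).
  apply: (H s t) => //; first by apply/eqP; rewrite eq_le gts -gms gmt.
  by move=> x; rewrite -gms; exact: hm.
have gms' : g m < g s.
  by rewrite lt_neqAle gms hm // lexx ltW.
have sm' : s < m.
  by rewrite lt_neqAle sm andbT; apply/eqP => sm'; rewrite sm' ltxx in gms'.
have [||q [/andP[q0 qs] gq hq _]] := @last_hit g 0 s (g m) gu s0.
- by apply: g0; rewrite (le_trans s0) // (le_trans mt).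
- exact: ltW.
apply: (H q m) => //; [exact: le_lt_trans qs sm'|exact: le_trans mt tw|].
move=> x /andP[qx xm]; rewrite gq; have [xs|/ltW sx] := lerP x s.
  by apply: hq; rewrite qx.
by apply: hm; rewrite sx (le_trans xm).
Qed.

End RealFunctions.

Section Homotopy.
Context {R : realType} {X : metricType R}.
Implicit Types (f a b c : R -> X) (s t u v p q e : R) (H : R -> R -> X).

Lemma ucont_continuous f : ucont f -> continuous f.
Proof.
move=> fu x; apply/cvg_ballP => e /fu[d d0 hd]; near=> y.
rewrite ball_mdist; apply: hd; near: y; exact: (@cvgr_dist_lt _ _ _ _ _ id x) d0.
Unshelve. all: by end_near. Qed.

Lemma ucont2_continuous H : ucont2 H -> continuous (fun z : R * R => H z.1 z.2).
Proof.
move=> Hu [x y]; apply/cvg_ballP => e /Hu[d d0 hd].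
apply: filterS (nbhsx_ballx (x, y) d d0) => z [xz yz].
by rewrite ball_mdist; exact: hd.
Qed.

Lemma ucont_comp f (h : R -> R) : ucont f -> ucontR h -> ucont (f \o h).
Proof.
move=> fu hu e /fu[d /hu[d' d'0 hd'] hd]; exists d' => // x y xy.
exact/hd/hd'.
Qed.

Lemma ucontR_lip (h : R -> R) (k : R) : 0 < k ->
  (forall x y, `|h x - h y| <= k * `|x - y|) -> ucontR h.
Proof.
move=> k0 hk e e0; exists (e / k); first by rewrite divr_gt0.
by move=> x y; rewrite ltr_pdivlMr // mulrC; exact: le_lt_trans.
Qed.

Lemma ucontR_clamp p q : ucontR (clamp p q).
Proof.
by apply: (@ucontR_lip _ 1) => // x y; rewrite mul1r clamp_lip.
Qed.

Lemma ucont2_clamp H p q : ucont2 H ->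
  ucont2 (fun t s => H (clamp p q t) (clamp 0 1 s)).
Proof.
move=> Hu e /Hu[d d0 hd]; exists d => // x y x' y' xx' yy'.
by apply: hd; exact: le_lt_trans (clamp_lip _ _ _ _) _.
Qed.

Lemma homotopy_clamp p q a b H : p <= q -> homotopy p q a b H ->
  homotopy p q a b (fun t s => H (clamp p q t) (clamp 0 1 s)).
Proof.
move=> pq [Hu H0 H1 Hs]; split; first exact: ucont2_clamp.
- by move=> t tpq; rewrite !clamp_id ?lexx ?ler01 // H0.
- by move=> t tpq; rewrite !clamp_id ?lexx ?ler01 // H1.
- by move=> s s01; rewrite !(clamp_id s01) !clamp_id ?lexx ?pq //; exact: Hs.
Qed.

Lemma compact_homotopy p q H : ucont2 H ->
  compact [set x | exists t s, x = H (clamp p q t) (clamp 0 1 s)].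
Proof.
move=> Hu; have [pq|qp] := lerP p q; last first.
  have c t : clamp p q t = p.
    by rewrite /clamp max_l // ge_min (ltW qp).
  have -> : [set x | exists t s, x = H (clamp p q t) (clamp 0 1 s)] =
      (fun z : R * R => H z.1 z.2) @` ([set p] `*` `[0, 1]).
    apply/seteqP; split=> [_ [t [s ->]]|_ [[x y] [/= -> yI] <-]].
      exists (clamp p q t, clamp 0 1 s) => //=; split => //.
      by rewrite /= in_itv /= clamp_in.
    by exists p, y; rewrite c clamp_id.
  apply: continuous_compact; first exact/continuous_subspaceT/ucont2_continuous.
  by apply: compact_setX; [exact: compact_set1|exact: segment_compact].
have -> : [set x | exists t s, x = H (clamp p q t) (clamp 0 1 s)] =
    (fun z : R * R => H z.1 z.2) @` (`[p, q] `*` `[0, 1]).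
  apply/seteqP; split=> [_ [t [s ->]]|_ [[x y] [/= xI yI] <-]].
    exists (clamp p q t, clamp 0 1 s) => //=; split => //;
    by rewrite /= in_itv /= clamp_in.
  by exists x, y; rewrite !clamp_id.
apply: continuous_compact; first exact/continuous_subspaceT/ucont2_continuous.
by apply: compact_setX; exact: segment_compact.
Qed.

Definition homotopic_on p q a b := exists H, homotopy p q a b H.

Lemma homotopic_on_loop p q a b : p <= q -> homotopic_on p q a b ->
  a p = b p /\ a q = b q.
Proof.
move=> pq [H [_ _ H1 Hs]]; have := Hs 1; rewrite lexx ler01 => /(_ isT)[<- <-].
by rewrite !H1 // lexx pq.
Qed.

Lemma homotopic_on_sym p q a b : p <= q -> homotopic_on p q a b ->
  homotopic_on p q b a.
Proof.
move=> pq ab; have [abp abq] := homotopic_on_loop pq ab.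
case: ab => H [Hu H0 H1 Hs]; exists (fun t s => H t (1 - s)); split.
- move=> e /Hu[d d0 hd]; exists d => // x y x' y' xx' yy'; apply: hd => //.
  by move: yy'; rewrite !ltr_norml; lra.
- by move=> t tpq; rewrite subr0 H1.
- by move=> t tpq; rewrite subrr H0.
- by move=> s s01; rewrite -abp -abq; apply: Hs; lra.
Qed.

Lemma homotopic_on_trans p q a b c : p <= q -> homotopic_on p q a b ->
  homotopic_on p q b c -> homotopic_on p q a c.
Proof.
move=> pq ab; have [abp abq] := homotopic_on_loop pq ab.
case: ab => H /(homotopy_clamp pq)[]; set H' := fun t s => _ => Hu H0 H1 Hs.
case=> K /(homotopy_clamp pq)[]; set K' := fun t s => _ => Ku K0 K1 Ks.
have glue t : H' t 1 = K' t 0.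
  rewrite /H' /K'; set t' := clamp p q t; have t'pq : p <= t' <= q by exact: clamp_in.
  have := H1 t' t'pq; have := K0 t' t'pq; rewrite /H' /K' !(clamp_id t'pq) => -> ->.
  by [].
exists (fun t s => if s <= 1 / 2 then H' t (2 * s) else K' t (2 * s - 1)); split.
- move=> e e0; have e2 : 0 < e / 2 by rewrite divr_gt0.
  have [d1 d10 hd1] := Hu _ e2; have [d2 d20 hd2] := Ku _ e2.
  exists (Num.min d1 d2 / 2); first by rewrite divr_gt0 // lt_min d10.
  move=> x y x' y' xx' yy'.
  have [m1 m2] : Num.min d1 d2 <= d1 /\ Num.min d1 d2 <= d2.
    by rewrite !ge_min !lexx orbT.
  have [x1 x2] : `|x - x'| < d1 /\ `|x - x'| < d2.
    have := normr_ge0 (x - x'); lra.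
  move: yy'; rewrite ltr_norml => yy'.
  have [y2|y2] := lerP y (1 / 2); have [y'2|y'2] := lerP y' (1 / 2).
  + apply: lt_trans (hd1 _ _ _ _ x1 _) _; [rewrite ltr_norml|]; lra.
  + have := metric_triangle (H' x (2 * y)) (H' x' 1) (K' x' (2 * y' - 1)).
    rewrite {2}glue.
    have := hd1 x (2 * y) x' 1 x1; have := hd2 x' 0 x' (2 * y' - 1).
    rewrite subrr normr0 !ltr_norml => h1 h2 h3.
    have {}h1 : mdist (K' x' 0) (K' x' (2 * y' - 1)) < e / 2 by apply: h1; lra.
    have {}h2 : mdist (H' x (2 * y)) (H' x' 1) < e / 2 by apply: h2; lra.
    lra.
  + have := metric_triangle (K' x (2 * y - 1)) (H' x 1) (H' x' (2 * y')).
    rewrite {1}glue.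
    have := hd1 x 1 x' (2 * y') x1; have := hd2 x (2 * y - 1) x 0.
    rewrite subrr normr0 !ltr_norml => h1 h2 h3.
    have {}h1 : mdist (K' x (2 * y - 1)) (K' x 0) < e / 2 by apply: h1; lra.
    have {}h2 : mdist (H' x 1) (H' x' (2 * y')) < e / 2 by apply: h2; lra.
    lra.
  + apply: lt_trans (hd2 _ _ _ _ x2 _) _; [rewrite ltr_norml|]; lra.
- move=> t tpq; have -> : 0 <= 1 / 2 :> R by rewrite divr_ge0.
  by rewrite mulr0; exact: H0.
- move=> t tpq; have -> : (1 <= 1 / 2 :> R) = false.
    by apply/negbTE; rewrite -ltNge; lra.
  have -> : 2 * 1 - 1 = 1 :> R by lra.
  exact: K1.
- move=> s /andP[s0 s1]; case: ifPn => [s2|]; first by apply: Hs; lra.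
  by rewrite -ltNge => s2; rewrite abp abq; apply: Ks; lra.
Qed.

(** Interpolate linearly between the parameters; the bound [M] makes the interpolation uniformly
    continuous in the homotopy variable. *)
Lemma homotopic_on_reparam p q f (al be : R -> R) (M : R) : p <= q -> 0 < M ->
  ucont f -> ucontR al -> ucontR be -> al p = be p -> al q = be q ->
  (forall t, p <= t <= q -> `|al t - be t| <= M) ->
  homotopic_on p q (f \o al) (f \o be).
Proof.
move=> pq M0 fu au bu eqp eqq abM.
pose ga t s := al t + s * (be t - al t).
exists (fun t s => f (ga (clamp p q t) (clamp 0 1 s))); split.
- move=> e /fu[d d0 hd]; have d3 : 0 < d / 4 by rewrite divr_gt0.
  have [d1 d10 hd1] := au _ d3; have [d2 d20 hd2] := bu _ d3.
  pose m := Num.min (Num.min d1 d2) (d / 4 / M).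
  have [m1 m2 m3] : [/\ m <= d1, m <= d2 & m <= d / 4 / M].
    by rewrite !ge_min !lexx !orbT.
  exists m; first by rewrite !lt_min d10 d20 divr_gt0.
  move=> x y x' y' xx' yy'; apply: hd; rewrite /ga.
  have := le_lt_trans (clamp_lip p q _ _) xx'; have := le_lt_trans (clamp_lip 0 1 _ _) yy'.
  set X1 := clamp p q x; set X2 := clamp p q x'; set Y1 := clamp 0 1 y.
  set Y2 := clamp 0 1 y' => Y12 X12.
  have h1 := hd1 _ _ (lt_le_trans X12 m1); have h2 := hd2 _ _ (lt_le_trans X12 m2).
  have YM : `|Y1 - Y2| * M < d / 4 by rewrite -ltr_pdivlMr // (lt_le_trans Y12).
  have Y201 : 0 <= Y2 <= 1 by exact: clamp_in.
  have h3 : `|(Y1 - Y2) * (al X1 - be X1)| < d / 4.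
    by rewrite normrM (le_lt_trans _ YM) // ler_wpM2l // abM // clamp_in.
  have -> : al X1 + Y1 * (be X1 - al X1) - (al X2 + Y2 * (be X2 - al X2)) =
    (al X1 - al X2) * (1 - Y2) + (be X1 - be X2) * Y2 - (Y1 - Y2) * (al X1 - be X1).
    by lra.
  have h4 : `|(al X1 - al X2) * (1 - Y2)| <= `|al X1 - al X2|.
    by apply: normM_le; case/andP: Y201 => ? ?; rewrite subr_ge0 gerBl; apply/andP.
  have h5 : `|(be X1 - be X2) * Y2| <= `|be X1 - be X2|.
    exact: normM_le.
  move: (le_lt_trans h4 h1) (le_lt_trans h5 h2) h3; rewrite !ltr_norml; lra.
- by move=> t tpq; rewrite /ga !clamp_id ?lexx ?ler01 // mul0r addr0.
- by move=> t tpq; rewrite /ga !clamp_id ?lexx ?ler01 // mul1r addrC subrK.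
- move=> s s01; rewrite /ga !(clamp_id s01) !clamp_id ?lexx ?pq //=.
  by rewrite eqp eqq !subrr !mulr0 !addr0.
Qed.

(* Letting [k] exchange the end points covers reversed paths. *)
Lemma nullhomotopy_comp p q p' q' a f (k : R -> R) H : p' <= q' -> ucontR k ->
  (forall t, p' <= t <= q' -> p <= k t <= q) ->
  (k p' = p \/ k p' = q) -> (k q' = p \/ k q' = q) ->
  (forall t, p' <= t <= q' -> a t = f (k t)) ->
  p <= q -> nullhomotopy p q f H -> nullhomotopy p' q' a (fun t s => H (k t) s).
Proof.
move=> pq' ku kin kp kq ak pq nH; have fpq := nullhomotopy_loop pq nH.
have [Hu H0 H1 Hs] := nH; have p'in : p' <= p' <= q' by rewrite lexx.
have q'in : p' <= q' <= q' by rewrite lexx pq'.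
have akp : a p' = f p by rewrite ak //; case: kp => ->.
have akq : a q' = f p by rewrite ak //; case: kq => ->.
split.
- move=> e /Hu[d d0 hd]; have [d' d'0 hd'] := ku _ d0.
  exists (Num.min d d'); first by rewrite lt_min d0.
  by move=> x y x' y'; rewrite !lt_min => /andP[_ /hd' h] /andP[h' _]; exact: hd.
- by move=> t tin; rewrite H0 ?ak //; exact: kin.
- by move=> t tin; rewrite H1 ?akp //; exact: kin.
- move=> s s01; have [Hp Hq] := Hs _ s01; rewrite akp akq; split.
    by case: kp => ->; rewrite ?Hp ?Hq.
  by case: kq => ->; rewrite ?Hp ?Hq.
Qed.

Lemma nullhomotopy_cst p q f : (forall t, p <= t <= q -> f t = f p) -> p <= q ->
  nullhomotopy p q f (fun _ _ => f p).
Proof.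
move=> fp pq; split=> // [e e0|t /fp->//|s _].
  by exists 1 => // *; rewrite mdistxx.
by rewrite (fp q) // lexx pq.
Qed.

Lemma homotopy_ext p q a b a' b' H : p <= q ->
  (forall t, p <= t <= q -> a t = a' t) -> (forall t, p <= t <= q -> b t = b' t) ->
  homotopy p q a b H -> homotopy p q a' b' H.
Proof.
move=> pq aa' bb' [Hu H0 H1 Hs]; split=> //.
- by move=> t tpq; rewrite H0 ?aa'.
- by move=> t tpq; rewrite H1 ?bb'.
- by move=> s /Hs; rewrite !aa' ?lexx ?pq.
Qed.

(** * Contracting a path inside the tree that codes it *)

Section Tree.
Variables (f : R -> X) (g : R -> R).
Hypotheses (gu : ucontR g) (g0 : forall t, 0 <= g t) (fg : tree_coded f g).

Lemma tree_coded_eq s t : 0 <= s -> s <= t -> t <= 1 -> g s = g t ->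
  (forall u, s <= u <= t -> g s <= g u) -> f s = f t.
Proof.
move=> s0 st t1 gst gu'; apply: mdist_positivity; apply/eqP.
rewrite eq_le mdist_ge0 andbT leNgt; apply/negP => /fg[k k0 hk].
have hh u : s <= u <= t -> g s - k < g u /\ g t - k < g u.
  by move=> /gu' h; rewrite -gst; split; lra.
by have := hk s t s0 st t1 hh; rewrite ltxx.
Qed.

(* Slide every point [t] forward along [f], to the first time at which [g] has
   decreased by the prescribed amount. *)
Lemma tree_retract u v : 0 <= u -> u <= v -> v <= 1 ->
  (forall t, u <= t <= v -> g u <= g t) ->
  exists H r, [/\ homotopy u v f (f \o r) H, forall t s, exists x, H t s = f x &
    forall t, u <= t <= v -> t <= r t <= v /\ g (r t) = runmin g v t].
Proof.
move=> u0 uv v1 guv.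
have [M M0 gM] : exists2 M, 0 < M & forall t, u <= t <= v -> g t <= M.
  have [|m _ hm] := @EVT_max R g u v uv.
    exact/continuous_subspaceT/ucontR_continuous.
  exists (g m + 1) => [|t tuv]; first by have := g0 m; lra.
  by have := hm t; rewrite in_itv /= => /(_ tuv); lra.
(* The level to which [t] has slid at time [s]. As [M] bounds [g] and [runmin] is nonnegative, the
   level at [s = 1] is [runmin g v t]. *)
pose la t s := Num.max (runmin g v t) (g t - s * M).
have rv t : u <= t <= v -> 0 <= runmin g v t <= g t.
  move=> /andP[ut tv]; have [m [_ -> hm]] := runminP gu tv.
  by rewrite g0 hm // lexx.
have /choice[q hq] : forall z : R * R, exists q, u <= z.1 <= v -> 0 <= z.2 ->
    [/\ z.1 <= q <= v, g q = la z.1 z.2 & forall w, z.1 <= w <= q -> la z.1 z.2 <= g w].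
  case=> t s /=; have [tuv|ntuv] := boolP (u <= t <= v); last by exists 0.
  have /andP[ut tv] := tuv.
  have [m [/andP[tm mv] rm hm]] := runminP gu tv.
  have [s0|s0] := lerP 0 s; last by exists 0 => _; lra.
  have [||q [/andP[tq qm] gq qw _]] := @first_hit R g t m (la t s) gu tm.
  - by rewrite le_max rm lexx.
  - by rewrite ge_max (andP (rv _ tuv)).2 gerBl mulr_ge0 // ltW.
  by exists q => _ _; split => //; rewrite tq (le_trans qm).
have c01 s : 0 <= clamp 0 1 s <= 1 by exact: clamp_in.
have cuv t : u <= clamp u v t <= v by exact: clamp_in.
pose Q t s := q (clamp u v t, clamp 0 1 s).
have hQ t s : [/\ clamp u v t <= Q t s <= v, g (Q t s) = la (clamp u v t) (clamp 0 1 s) &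
    forall w, clamp u v t <= w <= Q t s -> la (clamp u v t) (clamp 0 1 s) <= g w].
  exact: (hq (_, _) (cuv t) (proj1 (andP (c01 s)))).
have Qfix t s : u <= t <= v -> la t s = g t -> 0 <= s <= 1 -> f (Q t s) = f t.
  move=> tuv lat s01; have [] := hQ t s; rewrite !clamp_id // lat => /andP[tQ Qv] gQ Qw.
  symmetry; apply: tree_coded_eq => //; lra.
exists (fun t s => f (Q t s)), (fun t => Q t 1); split; first split.
- move=> e e0; have [k k0 hk] := fg e0; have k4 : 0 < k / 4 by rewrite divr_gt0.
  have [d1 d10 hd1] := gu k4.
  pose d := Num.min d1 (k / 4 / M).
  have [dd1 ddM] : d <= d1 /\ d <= k / 4 / M by rewrite !ge_min !lexx orbT.
  exists d; first by rewrite lt_min d10 !divr_gt0.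
  move=> x y x' y' xx' yy'.
  have {xx'}xx' := lt_le_trans (le_lt_trans (clamp_lip u v _ _) xx') dd1.
  have {yy'}yy' := lt_le_trans (le_lt_trans (clamp_lip 0 1 _ _) yy') ddM.
  have := hQ x y; have := hQ x' y'; move: (cuv x) (cuv x') xx' yy' (c01 y) (c01 y').
  set T := clamp u v x; set T' := clamp u v x'; set S := clamp 0 1 y.
  set S' := clamp 0 1 y'; move: (Q x y) (Q x' y') T T' S S' => p p' T T' S S'.
  clear x y x' y'.
  wlog TT' : T T' S S' p p' / T <= T'.
    move=> hw Tuv T'uv TT' SS' S01 S'01 h1 h2; have [|/ltW] := lerP T T'.
      by move=> TT''; apply: (hw T T' S S').
    by move=> TT''; rewrite metric_sym; apply: (hw T' T S' S); rewrite // distrC.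
  move=> /andP[uT Tv] /andP[uT' T'v] Td Sd S01 S'01.
  move=> [/andP[Tp' p'v] gp' p'w] [/andP[Tp pv] gp pw].
  have hr := runmin_close gu hd1 Tv T'v Td; have hg := hd1 _ _ Td.
  have hSM : `|S * M - S' * M| < k / 4.
    by rewrite -mulrBl normrM (gtr0_norm M0) -ltr_pdivlMr.
  have hla : `|la T S - la T' S'| < k / 2.
    apply: max_lip; first by apply: lt_trans hr _; lra.
    move: hg hSM; rewrite !ltr_norml; lra.
  clear hq hQ Qfix rv gM cuv c01 guv.
  move: hla; rewrite ltr_norml => hla.
  have gT : la T S <= g T by apply: pw; rewrite lexx.
  (* Each stopping time keeps [g] above its own level from its starting time on, and the two levels
     differ by less than [k / 2]. Only on the stretch up to [T'] is the closeness of [T] and [T']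
     needed. *)
  have [pp'|/ltW pp'] := lerP p p'.
    apply: hk => //; [lra|lra|] => w /andP[pw1 wp'].
    have [wT'|T'w] := lerP w T'.
      have : `|g T - g w| < k / 4.
        by apply: hd1; move: Td; rewrite !ltr_norml; lra.
      by rewrite ltr_norml; lra.
    have : la T' S' <= g w by apply: p'w; rewrite wp' ltW.
    lra.
  rewrite metric_sym; apply: hk => //; [lra|lra|] => w /andP[pw1 wp'].
  have : la T S <= g w by apply: pw; lra.
  lra.
- move=> t tuv; apply: Qfix; rewrite ?lexx ?ler01 //.
  by rewrite /la mul0r subr0; apply/max_idPr; have /andP[] := rv _ tuv.
- by [].
- move=> s s01; have su : la u s = g u.
    rewrite /la; have [m [muv -> hm]] := runminP gu uv.
    have -> : g m = g u.
      by apply/eqP; rewrite eq_le guv // andbT hm // lexx.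
    by apply/max_idPl; rewrite gerBl mulr_ge0 //; [have /andP[] := s01|exact: ltW].
  have sv : la v s = g v.
    rewrite /la; have [m [mvv -> hm]] := runminP gu (lexx v).
    have -> : m = v by lra.
    by apply/max_idPl; rewrite gerBl mulr_ge0 //; [have /andP[] := s01|exact: ltW].
  by rewrite !Qfix // ?lexx ?uv.
- by move=> t s; exists (Q t s).
- move=> t tuv; have [] := hQ t 1; rewrite !clamp_id ?ler01 ?lexx // => tQ -> _.
  split => //; rewrite /la mul1r; apply/max_idPl.
  by have := gM _ tuv; have /andP[] := rv _ tuv; lra.
Qed.

(** With equal end values the final level of the slide is [g u] throughout, so every [r t] codes the
    same point of the tree and [f \o r] is constant. *)
Lemma tree_null u v : 0 <= u -> u <= v -> v <= 1 -> g u = g v ->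
  (forall t, u <= t <= v -> g u <= g t) ->
  exists2 H, nullhomotopy u v f H & forall t s, exists x, H t s = f x.
Proof.
move=> u0 uv v1 guv gmin; have [H [r [hH Hf hr]]] := tree_retract u0 uv v1 gmin.
exists H => //; apply: homotopy_ext hH => // t tuv /=.
have [/andP[tr rt] gr] := hr _ tuv; have /andP[ut tv] := tuv.
have gru : g (r t) = g u.
  apply/eqP; rewrite eq_le gmin ?(le_trans ut) // andbT gr guv.
  by apply: runmin_le => //; rewrite tv lexx.
symmetry; apply: tree_coded_eq => //; [lra|lra|] => w /andP[uw wr].
by apply: gmin; rewrite uw (le_trans wr).
Qed.

End Tree.

(** * Existence of the normal form *)

Section OneDimensional.
Hypothesis lX : forall C : set X, compact C -> labelled C.

(* A null-homotopic subpath is null-homotopic in its own image, so that the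
   compact set used to define [g] need not contain the given null-homotopy. *)
Lemma tree_coding_null f : ucont f -> (forall t, f (clamp 0 1 t) = f t) ->
  exists g, [/\ ucontR g, forall t, 0 <= g t, g 0 = 0, tree_coded f g &
    forall p q H, 0 <= p -> p <= q -> q <= 1 -> nullhomotopy p q f H -> g p = g q].
Proof.
move=> fu fc.
have imf : compact (range f).
  have -> : range f = f @` `[0, 1].
    apply/seteqP; split=> [_ [t _ <-]|_ [t _ <-]]; last by exists t.
    by exists (clamp 0 1 t) => //=; rewrite in_itv /= clamp_in.
  apply: continuous_compact; last exact: segment_compact.
  exact/continuous_subspaceT/ucont_continuous.
have [g [gu g0 gz fg gn]] := tree_coding imf (lX imf) fu (fun t => imageT f t).
exists g; split=> // p q H p0 pq q1 nH; have q0 := le_trans p0 pq.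
pose f' := f \o clamp p q.
have f'E t : p <= t <= q -> f' t = f t by move=> tpq; rewrite /f' /= clamp_id.
have fu' : ucont f' by apply: ucont_comp fu _; exact: ucontR_clamp.
have nH' := homotopy_clamp pq nH.
have [H0 Hu] : (forall t, p <= t <= q -> H t 0 = f t) /\ ucont2 H by case: nH.
have cC := @compact_homotopy p q H Hu.
have fC' t : [set x | exists t s, x = H (clamp p q t) (clamp 0 1 s)] (f' t).
  by exists t, 0; rewrite (clamp_id (x := 0)) ?lexx ?ler01 // H0 // clamp_in.
have [g' [gu' g0' gz' fg' gn']] := tree_coding cC (lX cC) fu' fC'.
have nf' : nullhomotopy p q f' (fun t s => H (clamp p q t) (clamp 0 1 s)).
  by apply: homotopy_ext nH' => // t tpq; rewrite ?f'E ?lexx ?pq.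
have gpq' : g' p = g' q by apply: gn' nf' _ => // t s; exists t, s.
(* [f'] is constant before [p]; hence [g' p = g' 0 = 0] is the minimum of [g'], as [tree_null]
   demands. *)
have gp' : g' 0 = g' p.
  apply: (gn' 0 p (fun _ _ => f' 0)) => //; first exact: le_trans q1.
  apply: nullhomotopy_cst => // t /andP[_ tp].
  by rewrite /f' /= !clamp_lel.
have [|K nK Kf] := tree_null gu' g0' fg' p0 pq q1 gpq'.
  by move=> t _; rewrite -gp' gz'.
apply: (gn p q K) => //; last by move=> t s; have [x ->] := Kf t s; exists (clamp p q x).
by apply: homotopy_ext nK => // t tpq; rewrite f'E // lexx pq.
Qed.

(** [ta x] is the last time at height [x], so [ga] is parametrised by height. A null-homotopic piece
    of [ga] would make [f] null-homotopic between two times of different heights. The monotonicity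
    of [ta] serves the length estimate, and the last clause the case of a degenerate domain. *)
Theorem normal_form f : ucont f -> (forall t, f (clamp 0 1 t) = f t) ->
  exists L (ga : R -> X) (ta : R -> R), [/\ 0 <= L /\ ucont ga,
    homotopic_on 0 1 f (fun t => ga (t * L)),
    forall x y H, 0 <= x -> x < y -> y <= L -> ~ nullhomotopy x y ga H,
    [/\ forall x, 0 <= x <= L -> 0 <= ta x <= 1 /\ ga x = f (ta x),
      forall x y, 0 <= x -> x < y -> y <= L -> ta x < ta y,
      ta L = 1 & ga 0 = f 0] &
    (forall t, f t = f 0) -> L = 0].
Proof.
move=> fu fc; have [g [gu g0 gz fg gn]] := tree_coding_null fu fc.
pose L := g 1; have L0 : 0 <= L by exact: g0.
have /choice[ta0 hta0] : forall x, exists t, 0 <= x <= L ->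
    [/\ 0 <= t <= 1, g t = x, forall u, t <= u <= 1 -> x <= g u & x = L -> t = 1].
  move=> x; have [/andP[x0 xL]|nx] := boolP (0 <= x <= L); last by exists 0.
  have [||t ht] := @last_hit R g 0 1 x gu ler01; rewrite ?gz //.
  by exists t.
pose ta := ta0 \o clamp 0 L; pose ga := f \o ta.
have cL x : 0 <= clamp 0 L x <= L by exact: clamp_in.
have hta x : [/\ 0 <= ta x <= 1, g (ta x) = clamp 0 L x,
    forall u, ta x <= u <= 1 -> clamp 0 L x <= g u & clamp 0 L x = L -> ta x = 1].
  exact: hta0.
have ta_lt x y : clamp 0 L x < clamp 0 L y -> ta x < ta y.
  move=> xy; have [/andP[tx0 tx1] gx hx _] := hta x; have [_ gy hy _] := hta y.
  by rewrite ltNge; apply/negP => tyx; have := hy (ta x); rewrite tyx tx1 gx; lra.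
(* The choice of time is immaterial: any time at height [x] after which [g] stays above [x] codes
   the same point. *)
have gaE t x : 0 <= t <= 1 -> 0 <= x <= L -> g t = x ->
    (forall u, t <= u <= 1 -> x <= g u) -> ga x = f t.
  move=> /andP[t0 t1] xL gt ht; have [/andP[tx0 tx1] gx hx _] := hta x.
  rewrite clamp_id // in gx hx.
  have [tt|/ltW tt] := lerP (ta x) t.
    apply: (tree_coded_eq fg) => //; first by rewrite gx gt.
    by move=> u /andP[u1 u2]; rewrite gx hx // u1 (le_trans u2).
  symmetry; apply: (tree_coded_eq fg) => //; first by rewrite gx gt.
  by move=> u /andP[u1 u2]; rewrite gt ht // u1 (le_trans u2).
have gau : ucont ga.
  move=> e /fg[k k0 hk]; exists k => // x y xy.
  have {xy} := le_lt_trans (clamp_lip 0 L _ _) xy.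
  have [/andP[tx0 tx1] gx hx _] := hta x; have [/andP[ty0 ty1] gy hy _] := hta y.
  rewrite ltr_norml => xy; rewrite /ga /=.
  have [tt|/ltW tt] := lerP (ta x) (ta y).
    by apply: hk => // u /andP[u1 u2]; have := hx u; rewrite u1 (le_trans u2) // gx gy; lra.
  rewrite metric_sym; apply: hk => // u /andP[u1 u2].
  by have := hy u; rewrite u1 (le_trans u2) // gx gy; lra.
pose ph p q := runmin g q \o clamp p q.
have phu p q : p <= q -> ucontR (ph p q).
  move=> pq e /gu[d d0 hd]; exists d => // x y xy.
  have cq z : clamp p q z <= q by have /andP[] := clamp_in z pq.
  by apply: (runmin_close gu hd); rewrite ?cq //; exact: le_lt_trans (clamp_lip _ _ _ _) xy.
have php p q : p <= q -> (forall u, p <= u <= 1 -> g p <= g u) -> q <= 1 ->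
    ph p q p = g p.
  move=> pq hp q1; rewrite /ph /= clamp_id ?lexx ?pq //.
  have [m [/andP[pm mq] -> hm]] := runminP gu pq.
  by apply/eqP; rewrite eq_le hm ?lexx ?pq // hp // pm (le_trans mq).
have phq p q : p <= q -> ph p q q = g q.
  move=> pq; rewrite /ph /= clamp_id ?lexx ?pq //.
  by have [m [mq -> _]] := runminP gu (lexx q); have -> : m = q by lra.
have ph_bd p q t : p <= q -> q <= 1 -> (forall u, p <= u <= 1 -> g p <= g u) ->
    g p <= ph p q t <= g q.
  move=> pq q1 hp; rewrite /ph /=; have /andP[] := clamp_in t pq.
  move: (clamp p q t) => {}t pt tq.
  have [m [/andP[tm mq] rm hm]] := runminP gu tq; rewrite {1}rm hp ?(le_trans pt) //=.
    by apply: runmin_le; rewrite // tq lexx.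
  exact: le_trans q1.
(* Up to a later point [q] beyond which [g] stays above [g q], [f] is homotopic
   to the normal path run through at the pace [runmin g q]. *)
have pace p q : 0 <= p -> p <= q -> q <= 1 -> (forall u, p <= u <= 1 -> g p <= g u) ->
    (forall u, q <= u <= 1 -> g q <= g u) -> homotopic_on p q f (ga \o ph p q).
  move=> p0 pq q1 hp hq; have [|H [r [hH _ hr]]] := tree_retract gu g0 fg p0 pq q1.
    by move=> t /andP[pt tq]; apply: hp; rewrite pt (le_trans tq).
  exists H; apply: homotopy_ext hH => // t tpq /=.
  have [/andP[tr rt] gr] := hr _ tpq; have /andP[pt tq] := tpq.
  have := ph_bd p q t pq q1 hp; rewrite /ph /= clamp_id // => /andP[b1 b2].
  symmetry; apply: gaE; [lra| |exact: gr|].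
    by rewrite (le_trans (g0 p)) //= (le_trans b2) // hq // q1 lexx.
  move=> u /andP[ru u1].
  have [uq|/ltW qu] := lerP u q; first by apply: runmin_le => //; lra.
  by apply: (le_trans b2); apply: hq; rewrite qu.
exists L, ga, ta; split=> //.
- have z01 t : 0 <= t <= 1 -> g 0 <= g t by rewrite gz.
  have one t : 1 <= t <= 1 -> g 1 <= g t by move=> t1; have -> : t = 1 by lra.
  have hp0 := pace 0 1 (lexx 0) ler01 (lexx 1) z01 one.
  apply: (homotopic_on_trans ler01 hp0).
  apply: (@homotopic_on_reparam _ _ _ _ _ (L + 1)) => //.
  + lra.
  + exact: phu.
  + apply: (@ucontR_lip (fun t => t * L) (L + 1)) => [|x y]; first lra.
    rewrite -mulrBl normrM mulrC ger0_norm // ler_wpM2r //; lra.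
  + by rewrite php // gz mul0r.
  + by rewrite phq // mul1r.
  + move=> t /andP[t0 t1]; have /andP[] := ph_bd 0 1 t ler01 (lexx _) z01.
    rewrite gz -/L => b1 b2.
    have b3 : 0 <= t * L <= L by rewrite mulr_ge0 //= ler_piMl.
    by rewrite ler_norml; lra.
- move=> x y H x0 xy yL nH; have xL : x <= L by lra.
  have y0 : 0 <= y by lra.
  have [/andP[p0 p1] gp hp _] := hta x; have [/andP[q0 q1] gq hq _] := hta y.
  have cx : clamp 0 L x = x by rewrite clamp_id // x0.
  have cy : clamp 0 L y = y by rewrite clamp_id // y0.
  rewrite cx in gp hp; rewrite cy in gq hq.
  have pq : ta x <= ta y by apply/ltW/ta_lt; rewrite cx cy.
  have {}hp u : ta x <= u <= 1 -> g (ta x) <= g u by rewrite gp; exact: hp.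
  have {}hq u : ta y <= u <= 1 -> g (ta y) <= g u by rewrite gq; exact: hq.
  (* A contraction of [f] between these times would force [x = y] through [gn]. *)
  suff [K nK] : homotopic_on (ta x) (ta y) f (fun=> f (ta x)).
    by have := gn _ _ K p0 pq q1 nK; rewrite gp gq; lra.
  have hpq := pace _ _ p0 pq q1 hp hq; apply: (homotopic_on_trans pq hpq).
  have gax : ga (ph (ta x) (ta y) (ta x)) = f (ta x).
    rewrite php // gp; apply: gaE => //; rewrite ?p0 ?x0 //.
    by move=> u /hp; rewrite gp.
  exists (fun t s => H (ph (ta x) (ta y) t) s).
  have := @nullhomotopy_comp x y (ta x) (ta y) (ga \o ph (ta x) (ta y)) ga
    (ph (ta x) (ta y)) H pq (phu _ _ pq).
  rewrite /nullhomotopy /= gax; apply => //; last exact: ltW.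
  + by move=> t _; have := ph_bd _ _ t pq q1 hp; rewrite gp gq.
  + by left; rewrite php.
  + by right; rewrite phq.
- split.
  + move=> x _; have [] := hta x; by [].
  + move=> x y x0 xy yL; apply: ta_lt.
    by rewrite !clamp_id //; apply/andP; split; lra.
  + by have [_ _ _] := hta L; rewrite clamp_id ?lexx ?L0 //; apply.
  + apply: gaE => //; rewrite ?lexx ?ler01 ?L0 //.
- move=> fz; have nf : nullhomotopy 0 1 f (fun _ _ => f 0).
    by apply: nullhomotopy_cst => // t _; exact: fz.
  by rewrite /L -(gn _ _ _ (lexx 0) ler01 (lexx 1) nf).
Qed.

End OneDimensional.
End Homotopy.

(** * Uniqueness *)

Section Uniqueness.
Context {R : realType} {X : metricType R}.
Hypothesis lX : forall C : set X, compact C -> labelled C.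
Implicit Types (f a b : R -> X) (s t u v x y p q e : R) (H : R -> R -> X).

Definition nowhere_null a := forall x y H,
  0 <= x -> x < y -> y <= 1 -> ~ nullhomotopy x y a H.

Lemma ucont2_comp2 H (h k : R -> R -> R) :
  (forall e, 0 < e -> exists2 d, 0 < d & forall x y x' y',
    `|x - x'| < d -> `|y - y'| < d -> `|h x y - h x' y'| < e) ->
  (forall e, 0 < e -> exists2 d, 0 < d & forall x y x' y',
    `|x - x'| < d -> `|y - y'| < d -> `|k x y - k x' y'| < e) ->
  ucont2 H -> ucont2 (fun x y => H (h x y) (k x y)).
Proof.
move=> hu ku Hu e /Hu[d d0 hd]; have [d1 d10 h1] := hu _ d0.
have [d2 d20 h2] := ku _ d0; exists (Num.min d1 d2); first by rewrite lt_min d10.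
move=> x y x' y'; rewrite !lt_min => /andP[x1 x2] /andP[y1 y2].
by apply: hd; [exact: h1|exact: h2].
Qed.

(* The loop [a], then [b] backwards, is written as [H (tau t) (sig t)] with [H]
   a homotopy from [a] to [b]: this makes it continuous by construction, and
   null-homotopic through [H (min (tau t) (1 - s)) (sig t)]. *)
Lemma nowhere_null_match a b : homotopic_on 0 1 a b ->
  nowhere_null a -> nowhere_null b ->
  exists G1 G2 : R -> R, [/\ ucontR G1 /\ ucontR G2,
    forall x y, 0 <= x -> x < y -> y <= 1 -> G1 x < G1 y,
    forall x y, 0 <= x -> x < y -> y <= 1 -> G2 x < G2 y,
    G1 0 = G2 0 /\ G1 1 = G2 1 &
    forall s t, 0 <= s <= 1 -> 0 <= t <= 1 -> G1 s = G2 t -> a s = b t].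
Proof.
move=> [K /(homotopy_clamp ler01)]; set H := fun t s => K _ _ => -[Hu H0 H1 Hs] na nb.
(* [H] clamps its arguments, so [f] runs through [a] while [sig <= 0], rests at [a 1] while
   [tau >= 1], and runs back through [b] while [sig >= 1]. *)
pose tau t : R := Num.min (3 * t) (3 - 3 * t).
pose sig t : R := 3 * t - 1.
pose f t := H (tau (clamp 0 1 t)) (sig (clamp 0 1 t)).
pose N t s := H (Num.min (tau (clamp 0 1 t)) (1 - s)) (sig (clamp 0 1 t)).
have c01 t : 0 <= clamp 0 1 t <= 1 by exact: clamp_in.
have HL t s : t <= 0 -> H t s = H 0 s.
  by move=> t0; rewrite /H (clamp_lel ler01 t0) (clamp_lel ler01 (lexx 0)).
have HR t s : 1 <= t -> H t s = H 1 s.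
  by move=> t1; rewrite /H (clamp_ler ler01 t1) (clamp_ler ler01 (lexx 1)).
have HB t s : s <= 0 -> H t s = H t 0.
  by move=> s0; rewrite /H (clamp_lel ler01 s0) (clamp_lel ler01 (lexx 0)).
have HT t s : 1 <= s -> H t s = H t 1.
  by move=> s1; rewrite /H (clamp_ler ler01 s1) (clamp_ler ler01 (lexx 1)).
have Hs' s : H 0 s = a 0 /\ H 1 s = a 1.
  by have := Hs _ (c01 s); rewrite /H (clamp_id (c01 s)).
have tauu e : 0 < e -> exists2 d, 0 < d & forall x x', `|x - x'| < d ->
    `|tau (clamp 0 1 x) - tau (clamp 0 1 x')| < e.
  move=> e0; exists (e / 3) => [|x x' xx']; first by rewrite divr_gt0.
  by have := le_lt_trans (clamp_lip 0 1 _ _) xx'; rewrite /tau => h; apply: min_lip;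
    move: h; rewrite !ltr_norml; lra.
have sigu e : 0 < e -> exists2 d, 0 < d & forall x x', `|x - x'| < d ->
    `|sig (clamp 0 1 x) - sig (clamp 0 1 x')| < e.
  move=> e0; exists (e / 3) => [|x x' xx']; first by rewrite divr_gt0.
  by have := le_lt_trans (clamp_lip 0 1 _ _) xx'; rewrite /sig !ltr_norml; lra.
have Nu : ucont2 N.
  apply: (ucont2_comp2 _ _ Hu) => e e0.
    have [d d0 hd] := tauu _ e0; exists (Num.min d e); first by rewrite lt_min d0.
    move=> x y x' y'; rewrite !lt_min => /andP[xd _] /andP[_ ye].
    by apply: min_lip; [exact: hd|move: ye; rewrite !ltr_norml; lra].
  by have [d d0 hd] := sigu _ e0; exists d => // x y x' y' xd _; exact: hd.
have N0 t : N t 0 = f t.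
  by rewrite /N /f /H subr0; congr (K _ _); rewrite /clamp minC -minA minxx minC.
have fu : ucont f.
  move=> e /Nu[d d0 hd]; exists d => // x y xy.
  by rewrite -!N0; apply: hd; rewrite // subrr normr0.
have fc t : f (clamp 0 1 t) = f t by rewrite /f (clamp_id (c01 t)).
have f1 t : 0 <= t <= 1 / 3 -> f t = a (3 * t).
  move=> t13; rewrite /f clamp_id; last lra.
  rewrite HB /tau /sig; last lra.
  have -> : Num.min (3 * t) (3 - 3 * t) = 3 * t by apply/min_idPl; lra.
  by rewrite H0 //; lra.
have f2 t : 1 / 3 <= t <= 2 / 3 -> f t = a 1.
  move=> t13; rewrite /f clamp_id; last lra.
  rewrite HR; first by have [] := Hs' (sig t).
  by rewrite /tau le_min; apply/andP; split; lra.
have f3 t : 2 / 3 <= t <= 1 -> f t = b (3 - 3 * t).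
  move=> t13; rewrite /f clamp_id; last lra.
  rewrite HT /tau /sig; last lra.
  have -> : Num.min (3 * t) (3 - 3 * t) = 3 - 3 * t by apply/min_idPr; lra.
  by rewrite H1 //; lra.
have f0 : f 0 = a 0 by rewrite f1 ?mulr0 //; lra.
have nN : nullhomotopy 0 1 f N.
  split=> //.
  - by move=> t _; rewrite f0 /N subrr HL; [have [] := Hs' (sig (clamp 0 1 t))|rewrite ge_min lexx orbT].
  - move=> s _; rewrite f0.
    have t0 : tau 0 = 0 by rewrite /tau mulr0 subr0; apply/min_idPl.
    have t1 : tau 1 = 0 by rewrite /tau mulr1 subrr; apply/min_idPr; rewrite ler0n.
    rewrite /N /f !clamp_id ?lexx ?ler01 // t0 t1.
    rewrite !(HL (Num.min 0 _)) ?ge_min ?lexx //.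
    by have [-> _] := Hs' (sig 0); have [-> _] := Hs' (sig 1).
have [g [gu g0 gz fg gn]] := tree_coding_null lX fu fc.
have g1 : g 1 = 0 by rewrite -(gn _ _ _ (lexx 0) ler01 (lexx 1) nN).
have gmid t : 1 / 3 <= t <= 2 / 3 -> g (1 / 3) = g t.
  move=> /andP[t1 t2]; apply: (gn _ _ (fun _ _ => f (1 / 3))) => //; first lra.
  by apply: nullhomotopy_cst => // u /andP[u1 u2]; rewrite !f2 //; lra.
(* A failure of monotonicity would give, by [tree_null], a null-homotopic piece of [f] in the third
   that runs through [a]. *)
have i1 s t : 0 <= s -> s < t -> t <= 1 / 3 -> g s < g t.
  apply: (@ucontR_strict_mono _ g (1 / 3)) => //.
  - by move=> u _; rewrite gz.
  - move=> u v u0 uv v13 guv gmin.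
    have v1 : v <= 1 by lra.
    have [L nL _] := tree_null gu g0 fg u0 (ltW uv) v1 guv gmin.
    have ku : ucontR (fun t : R => t / 3).
      apply: (@ucontR_lip _ _ 1) => // x y.
      by rewrite mul1r -mulrBl normrM ler_piMr // ger0_norm; lra.
    apply: (na (3 * u) (3 * v) (fun t s => L (t / 3) s)); [lra|lra|lra|].
    apply: (nullhomotopy_comp _ ku _ _ _ _ _ nL); [lra|move=> x; lra|left; lra|right; lra| |exact: ltW].
    by move=> x xuv; rewrite f1 1?mulrC ?divfK //; lra.
have i2 s t : 0 <= s -> s < t -> t <= 1 / 3 -> g (1 - s) < g (1 - t).
  have gu' : ucontR (fun t => g (1 - t)).
    move=> e /gu[d d0 hd]; exists d => // x y xy; apply: hd.
    by move: xy; rewrite !ltr_norml; lra.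
  apply: (@ucontR_strict_mono _ (fun t => g (1 - t)) (1 / 3)) => //.
  - by move=> u _; rewrite subr0 g1.
  - move=> u v u0 uv v13 /= guv gmin.
    have v0 : 0 <= 1 - v by lra.
    have vu : 1 - v <= 1 - u by lra.
    have u1 : 1 - u <= 1 by lra.
    have [|L nL _] := tree_null gu g0 fg v0 vu u1 (esym guv).
      move=> t0 t01; rewrite -guv; have -> : t0 = 1 - (1 - t0) by lra.
      by apply: gmin; lra.
    have ku : ucontR (fun t : R => 1 - t / 3).
      apply: (@ucontR_lip _ _ 1) => // x y.
      have -> : 1 - x / 3 - (1 - y / 3) = (y - x) / 3 by lra.
      by rewrite mul1r distrC normrM ler_piMr // ger0_norm; lra.
    apply: (nb (3 * u) (3 * v) (fun t s => L (1 - t / 3) s)); [lra|lra|lra|].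
    apply: (nullhomotopy_comp _ ku _ _ _ _ _ nL); [lra|move=> x; lra|right; lra|left; lra| |done].
    move=> x xuv; rewrite f3; last lra.
    by congr b; lra.
exists (fun s => g (s / 3)), (fun s => g (1 - s / 3)); split.
- split=> e /gu[d d0 hd]; exists d => // x y xy; apply: hd;
  by move: xy; rewrite !ltr_norml; lra.
- by move=> x y x0 xy y1; apply: i1; lra.
- by move=> x y x0 xy y1; apply: i2; lra.
- rewrite mul0r subr0 gz g1; split => //.
  have -> : 1 - 1 / 3 = 2 / 3 :> R by lra.
  by apply: gmid; lra.
- move=> s t s01 t01 gst.
  have <- : f (s / 3) = a s by rewrite f1; [congr a|]; lra.
  have <- : f (1 - t / 3) = b t by rewrite f3; [congr b|]; lra.
  have i1' x y : 0 <= x -> x <= y -> y <= 1 / 3 -> g x <= g y.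
    by move=> x0; rewrite le_eqVlt => /predU1P[->//|xy] y1; apply/ltW/i1.
  (* Between [s / 3] and [1 - t / 3] the function [g] rises, rests and falls, so it stays above the
     common end value. *)
  apply: (tree_coded_eq fg) => //; [lra|lra|lra|].
  move=> u /andP[su ut]; have [u1|/ltW u1] := lerP u (1 / 3).
    by apply: i1' => //; lra.
  have [u2|/ltW u2] := lerP u (2 / 3).
    by rewrite -(gmid u) ?u1 //; apply: i1'; lra.
  rewrite gst; have [->//|ne] := eqVneq u (1 - t / 3).
  have -> : u = 1 - (1 - u) by lra.
  apply/ltW/i2; [lra| |lra].
  have : u < 1 - t / 3 by rewrite lt_neqAle ne ut.
  lra.
Qed.

End Uniqueness.

(** * Conversion between paths on intervals and uniformly continuous functions *)

Lemma compact_ucont (R : realType) (T Y : pseudoMetricType R) (A : set T)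
    (h : T -> Y) : compact A -> {within A, continuous h} ->
  forall e, 0 < e -> exists2 d, 0 < d &
    forall x y, A x -> A y -> ball x d y -> ball (h x) e (h y).
Proof.
move=> cA hA e e0.
suff [d d0 hd] : exists2 d, 0 < d & forall x, A x -> forall y, A y ->
    ball x d y -> ball (h x) e (h y).
  by exists d => // x y Ax Ay; exact: hd.
apply: compact_uniform => // [r r' x r'0 rr' hx y Ay xy|x Ax].
  by apply: hx => //; exact: le_ball rr' _ xy.
have e2 : 0 < e / 2 by rewrite divr_gt0.
have /nbhs_ballP[d /= d0 hd] : nbhs x [set y | A y -> ball (h x) (e / 2) (h y)].
  have /subspace_continuousP/(_ x Ax) := hA.
  by move=> /(_ _ (nbhsx_ballx (h x) _ e2)).
exists (d / 2) => [|y Ay xy z Az yz]; first by rewrite divr_gt0.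
have d2d : d / 2 <= d by lra.
rewrite [e]splitr; apply: (@ball_triangle _ _ (h x)).
  by apply/ball_sym; apply: hd => //; exact: le_ball d2d _ xy.
by apply: hd => //; rewrite [d]splitr; exact: ball_triangle xy yz.
Qed.

Section Conversion.
Context {R : realType} {X : metricType R}.
Implicit Types (c d : cpath X) (s t u v x y p q e : R).

Lemma within_ucont (f : R -> X) p q : p <= q -> {within `[p, q], continuous f} ->
  ucont (f \o clamp p q).
Proof.
move=> pq fc e e0; have [d d0 hd] := compact_ucont (@segment_compact R p q) fc e0.
exists d => // x y xy; rewrite -ball_mdist; apply: hd.
- by rewrite /= in_itv /= clamp_in.
- by rewrite /= in_itv /= clamp_in.
- exact: le_lt_trans (clamp_lip _ _ _ _) xy.
Qed.

Lemma within_ucontR (f : R -> R) p q : p <= q -> {within `[p, q], continuous f} ->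
  ucontR (f \o clamp p q).
Proof.
move=> pq fc e e0; have [d d0 hd] := compact_ucont (@segment_compact R p q) fc e0.
exists d => // x y xy; apply: hd.
- by rewrite /= in_itv /= clamp_in.
- by rewrite /= in_itv /= clamp_in.
- exact: le_lt_trans (clamp_lip _ _ _ _) xy.
Qed.

Lemma homotopy_of_fixed p q (f g : R -> X) (H : R * R -> X) : p <= q ->
  fixed_endpoint_homotopy p q f g H ->
  homotopy p q f g (fun t s => H (clamp p q t, clamp 0 1 s)).
Proof.
move=> pq [Hc H0 H1 Hs]; split.
- move=> e e0; have [d d0 hd] := compact_ucont
    (compact_setX (@segment_compact R p q) (@segment_compact R 0 1)) Hc e0.
  exists d => // x y x' y' xx' yy'; rewrite -ball_mdist; apply: hd.
  + by split; rewrite /= in_itv /= clamp_in.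
  + by split; rewrite /= in_itv /= clamp_in.
  + by split; [exact: le_lt_trans (clamp_lip _ _ _ _) xx'|
      exact: le_lt_trans (clamp_lip _ _ _ _) yy'].
- by move=> t tpq; rewrite !clamp_id ?lexx ?ler01 // H0 // in_itv.
- by move=> t tpq; rewrite !clamp_id ?lexx ?ler01 // H1 // in_itv.
- move=> s s01; rewrite (clamp_id s01) !clamp_id ?lexx ?pq //.
  by apply: Hs; rewrite in_itv.
Qed.

Lemma fixed_of_homotopy p q (f g : R -> X) (H : R -> R -> X) :
  homotopy p q f g H -> fixed_endpoint_homotopy p q f g (fun z => H z.1 z.2).
Proof.
move=> [Hu H0 H1 Hs]; split.
- exact/continuous_subspaceT/ucont2_continuous.
- by move=> t; rewrite in_itv /=; exact: H0.
- by move=> t; rewrite in_itv /=; exact: H1.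
- by move=> s; rewrite in_itv /=; exact: Hs.
Qed.

(** The affine reparametrisation over [[0, 1]]; a degenerate path becomes a constant one, in
    agreement with [represents]. *)
Definition hat c t : X := c (domL c + clamp 0 1 t * (domR c - domL c)).

Let clamp01 t : 0 <= clamp 0 1 t <= 1. Proof. exact: clamp_in. Qed.

Lemma affine_in c t : domL c <= domL c + clamp 0 1 t * (domR c - domL c) <= domR c.
Proof.
have LR := domLR c; have /andP[t0 t1] := clamp01 t.
rewrite lerDl mulr_ge0 ?subr_ge0 //= -lerBrDl ler_piMl ?subr_ge0 //.
Qed.

Lemma ucontR_affine (k m : R) : ucontR (fun t => k + clamp 0 1 t * m).
Proof.
apply: (@ucontR_lip _ _ (`|m| + 1)) => [|x y]; first by have := normr_ge0 m; lra.
rewrite opprD addrACA subrr add0r -mulrBl normrM mulrC.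
by rewrite ler_pM ?normr_ge0 ?clamp_lip // lerDl.
Qed.

Lemma hat_ucont c : ucont (hat c).
Proof.
have -> : hat c = (c \o clamp (domL c) (domR c)) \o
    (fun t => domL c + clamp 0 1 t * (domR c - domL c)).
  by apply/funext => t /=; rewrite clamp_id // affine_in.
apply: ucont_comp; last exact: ucontR_affine.
by apply: within_ucont; [exact: domLR|exact: cfun_continuous].
Qed.

Lemma hat_clamp c t : hat c (clamp 0 1 t) = hat c t.
Proof. by rewrite /hat (clamp_id (clamp01 t)). Qed.

Lemma hat_degenerate c t : domL c = domR c -> hat c t = c (domL c).
Proof. by move=> LR; rewrite /hat LR subrr mulr0 addr0. Qed.

Lemma hatE c x : domL c < domR c -> domL c <= x <= domR c ->
  hat c ((x - domL c) / (domR c - domL c)) = c x.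
Proof.
move=> LR /andP[Lx xR]; have LR' : 0 < domR c - domL c by rewrite subr_gt0.
have m0 : domR c - domL c != 0 by rewrite gt_eqF.
rewrite /hat clamp_id; first by rewrite (divfK m0) subrKC.
apply/andP; split; first by apply: divr_ge0; rewrite subr_ge0 // ltW.
by rewrite ler_pdivrMr // mul1r lerD2r.
Qed.

Lemma homotopic_on_eq (f g : R -> X) p q : ucont f ->
  (forall t, p <= t <= q -> f t = g t) -> homotopic_on p q f g.
Proof.
move=> fu fg; exists (fun t _ => f t); split=> //.
by move=> e /fu[d d0 hd]; exists d => // x y x' y' xx' _; exact: hd.
Qed.

(** The change of parameter fixes the ends, so it can be interpolated linearly to the affine one. *)
Lemma represents_hat c c' : represents c c' -> homotopic_on 0 1 (hat c) (hat c').
Proof.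
case=> [[h [g [[hAB gLR] [hK gK] [hc gc] hm]] c'E]|[LR c'E]]; last first.
  apply: homotopic_on_eq; first exact: hat_ucont.
  move=> t _; rewrite hat_degenerate // /hat c'E //.
  by rewrite in_itv /= affine_in.
pose A := domL c'; pose B := domR c'; pose L := domL c; pose S := domR c.
have AB : A <= B := domLR c'; have LS : L <= S := domLR c.
have hin x : A <= x <= B -> L <= h x <= S.
  by move=> xAB; have := hAB x; rewrite /= !in_itv /=; apply.
have gin x : L <= x <= S -> A <= g x <= B.
  by move=> xLS; have := gLR x; rewrite /= !in_itv /=; apply.
have hmono x y : A <= x <= B -> A <= y <= B -> x <= y -> h x <= h y.
  by move=> xAB yAB; apply: hm; rewrite in_itv.
have gKE x : L <= x <= S -> h (g x) = x by move=> xLS; apply: gK; rewrite in_itv.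
have hA : h A = L.
  have LL : L <= L <= S by rewrite lexx.
  have AA : A <= A <= B by rewrite lexx.
  apply/eqP; rewrite eq_le; have /andP[-> _] := hin _ AA; rewrite andbT -[leRHS](gKE L) //.
  by apply: hmono => //; [exact: gin|have /andP[] := gin _ LL].
have hB : h B = S.
  have LL : L <= S <= S by rewrite lexx LS.
  have AA : A <= B <= B by rewrite lexx AB.
  apply/eqP; rewrite eq_le; have /andP[_ ->] := hin _ AA; rewrite /= -[leLHS](gKE S) //.
  by apply: hmono => //; [exact: gin|have /andP[] := gin _ LL].
have c0u : ucont (c \o clamp L S).
  by apply: within_ucont => //; exact: cfun_continuous.
have hu : ucontR (h \o clamp A B) by exact: within_ucontR.
have chE t : hat c t = (c \o clamp L S) (L + clamp 0 1 t * (S - L)).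
  by rewrite /= clamp_id // affine_in.
have cinA t : A <= A + clamp 0 1 t * (B - A) <= B by exact: affine_in.
have chE' t : hat c' t =
    (c \o clamp L S) ((h \o clamp A B) (A + clamp 0 1 t * (B - A))).
  rewrite /= (clamp_id (cinA t)) clamp_id; last exact: hin.
  by rewrite /hat c'E // in_itv /= affine_in.
have [K [Ku K0 K1 Ks]] : homotopic_on 0 1
    ((c \o clamp L S) \o (fun t => L + clamp 0 1 t * (S - L)))
    ((c \o clamp L S) \o (fun t => (h \o clamp A B) (A + clamp 0 1 t * (B - A)))).
  apply: (@homotopic_on_reparam _ _ _ _ _ _ _ (S - L + 1)) => //.
  - lra.
  - exact: ucontR_affine.
  - move=> e /hu[d d0 hd]; have [d' d'0 hd'] := ucontR_affine A (B - A) d0.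
    by exists d' => // x y xy; apply/hd/hd'.
  - by rewrite clamp00 !mul0r !addr0 /= clamp_id ?lexx ?AB ?hA.
  - rewrite clamp11 !mul1r !subrKC /= clamp_id ?lexx ?AB ?hB //.
  - move=> t _ /=; rewrite (clamp_id (cinA t)).
    have := hin _ (cinA t); have := affine_in c t; rewrite -/L -/S => h1 h2.
    rewrite ler_norml; lra.
exists K; split=> //.
- by move=> t t01; rewrite chE K0.
- by move=> t t01; rewrite chE' K1.
- by move=> s s01; rewrite !chE; exact: Ks.
Qed.

Lemma homotopic_hat c1 c2 : homotopic c1 c2 -> homotopic_on 0 1 (hat c1) (hat c2).
Proof.
move=> [c1' [c2' [/represents_hat r1 /represents_hat r2 [eL eR] [H hH]]]].
apply: (homotopic_on_trans ler01 r1); apply: (homotopic_on_trans ler01);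
  last exact: homotopic_on_sym ler01 r2.
have [Ku K0 K1 Ks] := homotopy_of_fixed (domLR c1') hH.
set K := fun t s => _ in Ku K0 K1 Ks.
pose k t := domL c1' + clamp 0 1 t * (domR c1' - domL c1').
have k0 : k 0 = domL c1' by rewrite /k clamp00 mul0r addr0.
have k1 : k 1 = domR c1' by rewrite /k clamp11 mul1r subrKC.
exists (fun t s => K (k t) s); split.
- move=> e /Ku[d d0 hd]; have [d' d'0 hd'] := ucontR_affine (domL c1') (domR c1' - domL c1') d0.
  exists (Num.min d d'); first by rewrite lt_min d0.
  by move=> x y x' y'; rewrite !lt_min => /andP[_ /hd' h] /andP[h' _]; exact: hd.
- by move=> t _; apply: K0; exact: affine_in.
- by move=> t _; rewrite /hat -eL -eR; apply: K1; exact: affine_in.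
- move=> s s01; rewrite /hat -/(k 0) -/(k 1) k0 k1; exact: Ks.
Qed.

Lemma continuous_affine (k m : R) (A : set R) :
  {within A, continuous (fun t => k + t * m)}.
Proof.
apply/continuous_subspaceT/ucontR_continuous.
apply: (@ucontR_lip _ _ (`|m| + 1)) => [|x y]; first by have := normr_ge0 m; lra.
rewrite opprD addrACA subrr add0r -mulrBl normrM mulrC.
by rewrite ler_wpM2r // lerDl.
Qed.

Lemma hat_continuous c : {within `[0, 1], continuous (hat c)}.
Proof. exact/continuous_subspaceT/ucont_continuous/hat_ucont. Qed.

Definition hat_path c : cpath X := CPath ler01 (@hat_continuous c).

Lemma represents_hat_path c : represents c (hat_path c).
Proof.
have LR := domLR c; have [LR'|LR'] := eqVneq (domL c) (domR c).
  by right; split => // t _; exact: hat_degenerate.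
have {LR'}LR' : 0 < domR c - domL c by rewrite subr_gt0 lt_neqAle LR' LR.
left; exists (fun t => domL c + t * (domR c - domL c)); last first.
  by move=> t; rewrite in_itv /= => t01; rewrite /hat clamp_id.
exists (fun x => - domL c / (domR c - domL c) + x * (domR c - domL c)^-1); split.
- split=> t; rewrite /= !in_itv /= => /andP[t0 t1].
    by have := affine_in c t; rewrite clamp_id ?t0.
  rewrite -mulrDl [- _ + _]addrC; apply/andP; split.
    by apply: divr_ge0; rewrite ?subr_ge0 // ltW.
  by rewrite ler_pdivrMr // mul1r lerD2r.
- split=> t _.
    by rewrite -mulrDl addrA addNr add0r mulfK // gt_eqF.
  by rewrite -mulrDl divfK ?gt_eqF // addrA subrr add0r.
- by split; exact: continuous_affine.
- by move=> x y _ _ xy; rewrite lerD2l ler_wpM2r // ltW.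
Qed.

Lemma hat_homotopic c1 c2 : homotopic_on 0 1 (hat c1) (hat c2) -> homotopic c1 c2.
Proof.
move=> [H /fixed_of_homotopy hH]; exists (hat_path c1), (hat_path c2).
by split; [exact: represents_hat_path|exact: represents_hat_path|split|
  exists (fun z => H z.1 z.2)].
Qed.

Lemma normal_nowhere_null c : domL c < domR c -> normal_path c ->
  nowhere_null (hat c).
Proof.
move=> LR nc x y K x0 xy y1 nK; have LR' : 0 < domR c - domL c by rewrite subr_gt0.
pose L := domL c; pose m := domR c - L.
have m0 : m != 0 by rewrite gt_eqF.
pose p := L + x * m; pose q := L + y * m.
have pq : p < q by rewrite ltrD2l ltr_pM2r.
have Lp : L <= p by rewrite lerDl mulr_ge0 // ltW.
have qR : q <= domR c by rewrite /q -lerBrDl ler_piMl // ltW.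
have ku : ucontR (fun t => (t - L) / m).
  apply: (@ucontR_lip _ _ m^-1) => [|s t]; first by rewrite invr_gt0.
  rewrite -mulrBl opprD addrACA subrr addr0 normrM mulrC.
  by rewrite gtr0_norm ?invr_gt0.
have kp : (p - L) / m = x by rewrite /p addrAC subrr add0r mulfK.
have kq : (q - L) / m = y by rewrite /q addrAC subrr add0r mulfK.
have nK' : nullhomotopy p q c (fun t s => K ((t - L) / m) s).
  apply: (nullhomotopy_comp (ltW pq) ku _ _ _ _ (ltW xy) nK).
  - move=> t /andP[pt tq]; rewrite -kp -kq.
    by rewrite !ler_pM2r ?invr_gt0 // !lerD2r pt.
  - by left.
  - by right.
  - move=> t /andP[pt tq]; rewrite -/L -/m hatE //.
    by rewrite (le_trans Lp) //= (le_trans tq).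
apply: nc; exists p, q; split=> //.
  by rewrite (nullhomotopy_loop (ltW pq) nK').
exists (fun z => K ((z.1 - L) / m) z.2).
exact: (fixed_of_homotopy nK').
Qed.

(** [h] is [A1] followed by the inverse of [A2], found with the intermediate value theorem; an
    increasing surjection between segments is continuous. *)
Lemma increasing_homeo_of_match a b a' b' (A1 A2 : R -> R) : a <= b -> a' <= b' ->
  {within `[a, b], continuous A1} -> {within `[a', b'], continuous A2} ->
  (forall x y, a <= x -> x < y -> y <= b -> A1 x < A1 y) ->
  (forall x y, a' <= x -> x < y -> y <= b' -> A2 x < A2 y) ->
  A1 a = A2 a' -> A1 b = A2 b' ->
  exists2 h, increasing_homeo a b a' b' h &
    forall x, a <= x <= b -> a' <= h x <= b' /\ A2 (h x) = A1 x.
Proof.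
move=> ab ab' c1 c2 m1 m2 ea eb.
have mle (B : R -> R) p q : (forall x y, p <= x -> x < y -> y <= q -> B x < B y) ->
    forall x y, p <= x -> x <= y -> y <= q -> B x <= B y.
  by move=> mB x y px; rewrite le_eqVlt => /predU1P[->//|xy] yq; exact/ltW/mB.
have mrefl (B : R -> R) p q : (forall x y, p <= x -> x < y -> y <= q -> B x < B y) ->
    forall x y, p <= x <= q -> p <= y <= q -> B x <= B y -> x <= y.
  move=> mB x y /andP[px xq] /andP[py yq] Bxy; rewrite leNgt; apply/negP => yx.
  by have := mB _ _ py yx xq; rewrite ltNge Bxy.
have solve p q p' q' (B B' : R -> R) : p <= q -> p' <= q' ->
    {within `[p', q'], continuous B'} ->
    (forall x y, p <= x -> x < y -> y <= q -> B x < B y) ->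
    (forall x y, p' <= x -> x < y -> y <= q' -> B' x < B' y) ->
    B p = B' p' -> B q = B' q' ->
    forall x, exists y, p <= x <= q -> p' <= y <= q' /\ B' y = B x.
  move=> pq pq' cB' mB mB' ep eq x.
  have [/andP[px xq]|nx] := boolP (p <= x <= q); last by exists 0.
  have Bp := mle _ _ _ mB _ _ (lexx p) px xq; have Bq := mle _ _ _ mB _ _ px xq (lexx q).
  have [|y] := @IVT R B' p' q' (B x) pq' cB'.
    by rewrite ge_min le_max -ep Bp -eq Bq orbT.
  by rewrite in_itv /= => ypq Byx; exists y.
have /choice[h hh] := solve _ _ _ _ _ _ ab ab' c2 m1 m2 ea eb.
have /choice[g gg] := solve _ _ _ _ _ _ ab' ab c1 m2 m1 (esym ea) (esym eb).
have hK x : a <= x <= b -> g (h x) = x.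
  move=> xab; have [hx ex] := hh _ xab; have [gx egx] := gg _ hx.
  by apply/le_anti/andP; split; apply: (mrefl _ _ _ m1) => //; rewrite egx ex.
have gK x : a' <= x <= b' -> h (g x) = x.
  move=> xab; have [gx egx] := gg _ xab; have [hx ex] := hh _ gx.
  by apply/le_anti/andP; split; apply: (mrefl _ _ _ m2) => //; rewrite ex egx.
have hle x y : a <= x <= b -> a <= y <= b -> (h x <= h y) = (x <= y).
  move=> xab yab; have [hx ex] := hh _ xab; have [hy ey] := hh _ yab.
  apply/idP/idP => [hxy|xy].
    apply: (mrefl _ _ _ m1) => //; rewrite -ex -ey.
    by apply: (mle _ _ _ m2) => //; [case/andP: hx|case/andP: hy].
  apply: (mrefl _ _ _ m2) => //; rewrite ex ey.
  by apply: (mle _ _ _ m1) => //; [case/andP: xab|case/andP: yab].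
have gle x y : a' <= x <= b' -> a' <= y <= b' -> (g x <= g y) = (x <= y).
  move=> xab yab; have [gx _] := gg _ xab; have [gy _] := gg _ yab.
  by rewrite -hle // !gK.
have aab : a <= a <= b by rewrite lexx.
have bab : a <= b <= b by rewrite lexx ab.
have aab' : a' <= a' <= b' by rewrite lexx.
have bab' : a' <= b' <= b' by rewrite lexx ab'.
have surj p q (k k' : R -> R) : (forall x, k p <= x <= k q -> p <= k' x <= q /\ k (k' x) = x) ->
    set_surj `[p, q] `[k p, k q] k.
  move=> hk x; rewrite /= in_itv /= => /hk[kx ek]; exists (k' x) => //.
exists h => //; exists g; split.
- by split=> x; rewrite /= !in_itv /= => xin; [have [] := hh _ xin|have [] := gg _ xin].
- by split=> x; rewrite in_itv /= => xin; [exact: hK|exact: gK].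
- split; apply: segment_inc_surj_continuous.
  + by move=> x y; rewrite !in_itv /= => xab yab; exact: hle.
  + apply: (surj _ _ h g) => x /andP[hax xhb].
    have xin : a' <= x <= b'.
      have [/andP[h1 _] _] := hh _ aab; have [/andP[_ h2] _] := hh _ bab.
      by rewrite (le_trans h1) //= (le_trans xhb).
    by have [] := gg _ xin; rewrite gK.
  + by move=> x y; rewrite !in_itv /= => xab yab; exact: gle.
  + apply: (surj _ _ g h) => x /andP[hax xhb].
    have xin : a <= x <= b.
      have [/andP[h1 _] _] := gg _ aab'; have [/andP[_ h2] _] := gg _ bab'.
      by rewrite (le_trans h1) //= (le_trans xhb).
    by have [] := hh _ xin; rewrite hK.
- by move=> x y; rewrite !in_itv /= => xab yab; rewrite hle.
Qed.

Section Unique.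
Hypothesis lX : forall C : set X, compact C -> labelled C.

Lemma normal_null_degenerate c K : normal_path c -> nullhomotopy 0 1 (hat c) K ->
  domL c = domR c.
Proof.
move=> nc nK; apply/eqP; apply: contraPT (domLR c) => LR.
rewrite le_eqVlt (negbTE LR) /= => /normal_nowhere_null/(_ nc 0 1 K); exact.
Qed.

Lemma degenerate_homotopic c d : domL c = domR c -> normal_path d ->
  homotopic_on 0 1 (hat c) (hat d) -> domL d = domR d.
Proof.
move=> LR nd cd; have [e0 _] := homotopic_on_loop ler01 cd.
have [K nK] := homotopic_on_sym ler01 cd.
apply: (normal_null_degenerate (K := K)) nd _.
by apply: homotopy_ext nK => // t _; rewrite -e0 !hat_degenerate.
Qed.

Lemma normal_path_unique c d : normal_path c -> normal_path d ->
  homotopic_on 0 1 (hat c) (hat d) -> frechet c d.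
Proof.
move=> nc nd cd; have LRc := domLR c; have LRd := domLR d.
(* [hat] of a degenerate path is constant on [[0, 1]] and so not [nowhere_null]; this case is
   settled separately. *)
have [dc|ndc] := eqVneq (domL c) (domR c).
  have dd := degenerate_homotopic dc nd cd.
  have [] := homotopic_on_loop ler01 cd; rewrite !hat_degenerate // => ecd _.
  exists (fun=> domL d); last first.
    by move=> x; rewrite in_itv /= -dc => xc; have -> : x = domL c by lra.
  exists (fun=> domL c); split.
  - by split=> x; rewrite /= !in_itv /= lexx ?LRc ?LRd.
  - split=> x; rewrite in_itv /=; first by rewrite -dc => xc; lra.
    by rewrite -dd => xc; lra.
  - by split; apply: continuous_subspaceT => x; exact: cvg_cst.
  - by [].
have {}ndc : domL c < domR c by rewrite lt_neqAle ndc.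
have ndd : domL d < domR d.
  rewrite lt_neqAle LRd andbT; apply/eqP => dd.
  have := degenerate_homotopic dd nc (homotopic_on_sym ler01 cd).
  by move=> e; rewrite e ltxx in ndc.
have [G1 [G2 [[u1 u2] m1 m2 [e0 e1] GG]]] := nowhere_null_match lX cd
  (normal_nowhere_null ndc nc) (normal_nowhere_null ndd nd).
pose k (c0 : cpath X) x := (x - domL c0) / (domR c0 - domL c0).
have kin (c0 : cpath X) x : domL c0 < domR c0 -> domL c0 <= x <= domR c0 ->
    0 <= k c0 x <= 1.
  move=> LR /andP[Lx xR]; have LR' : 0 < domR c0 - domL c0 by rewrite subr_gt0.
  by rewrite divr_ge0 ?subr_ge0 ?(ltW LR) //= ler_pdivrMr // mul1r lerD2r.
have klt (c0 : cpath X) x y : domL c0 < domR c0 -> x < y -> k c0 x < k c0 y.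
  by move=> LR xy; rewrite ltr_pM2r ?invr_gt0 ?subr_gt0 // ltrD2r.
have k0 (c0 : cpath X) : k c0 (domL c0) = 0 by rewrite /k subrr mul0r.
have k1 (c0 : cpath X) : domL c0 < domR c0 -> k c0 (domR c0) = 1.
  by move=> LR; rewrite /k divff // gt_eqF // subr_gt0.
have kc (c0 : cpath X) (G : R -> R) : domL c0 < domR c0 -> ucontR G ->
    {within `[domL c0, domR c0], continuous (G \o k c0)}.
  move=> LR Gu; apply/continuous_subspaceT/ucontR_continuous => e /Gu[z z0 hz].
  have LR' : 0 < domR c0 - domL c0 by rewrite subr_gt0.
  exists (z * (domR c0 - domL c0)); first by rewrite mulr_gt0.
  move=> x y xy; apply: hz; rewrite /k -mulrBl opprD addrACA subrr addr0.
  by rewrite normrM (gtr0_norm (_ : 0 < _^-1)) ?invr_gt0 // ltr_pdivrMr.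
have km (c0 : cpath X) (G : R -> R) : domL c0 < domR c0 ->
    (forall x y, 0 <= x -> x < y -> y <= 1 -> G x < G y) ->
    forall x y, domL c0 <= x -> x < y -> y <= domR c0 -> (G \o k c0) x < (G \o k c0) y.
  move=> LR mG x y Lx xy yR; apply: mG; last 1 first.
  - by have /andP[] := kin c0 y LR (introT andP (conj (le_trans Lx (ltW xy)) yR)).
  - by have /andP[] := kin c0 x LR (introT andP (conj Lx (le_trans (ltW xy) yR))).
  - exact: klt.
have [||h hh hE] := increasing_homeo_of_match LRc LRd (kc _ _ ndc u1) (kc _ _ ndd u2)
  (km _ _ ndc m1) (km _ _ ndd m2).
- by rewrite /= !k0.
- by rewrite /= !k1.
exists h => // x; rewrite in_itv /= => xin; have [hx ex] := hE _ xin.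
rewrite /= -(hatE ndc xin) -(hatE ndd hx).
by apply: GG; [exact: kin|exact: kin|exact/esym].
Qed.

End Unique.

End Conversion.

(** * The normal path and its length *)

Lemma path_lt_last (R : realType) (x : R) s : path <%O x s ->
  forall y, y \in x :: s -> y <= last x s.
Proof.
elim: s x => [|z s IH] x /= => [_ y|/andP[xz ps] y]; first by rewrite inE => /eqP ->.
rewrite inE => /predU1P[->|ys]; last exact: IH ps _ ys.
by apply: le_trans (ltW xz) (IH _ ps z _); rewrite inE eqxx.
Qed.

Theorem theorem10 (R : realType) (X : metricType R)
    (hX : one_dimensional X) (c : cpath X) :
  exists cn : cpath X,
    [/\ normal_path cn, homotopic c cn,
        (forall d : cpath X, normal_path d -> homotopic c d -> frechet d cn) &
        (plength cn <= plength c)%E].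
Proof.
have lX C := @labelled_one_dimensional R X C hX.
have LR := domLR c.
have [L [ga [ta [[L0 gau] hga nga [gaE ta_lt taL ga0] Lcst]]]] :=
  normal_form lX (hat_ucont c) (hat_clamp c).
have gac : {within `[0, L], continuous ga}.
  exact/continuous_subspaceT/ucont_continuous.
pose cn := CPath L0 gac.
have hcn : homotopic_on 0 1 (hat c) (hat cn).
  case: hga => H hH; exists H; apply: homotopy_ext hH => // t t01.
  by rewrite /hat /= clamp_id // add0r subr0.
have ncn : normal_path cn.
  move=> [u [v [/= u0 uv vL _ [H hH]]]].
  exact: (nga u v _ u0 uv vL (homotopy_of_fixed (ltW uv) hH)).
exists cn; split=> //.
- exact: hat_homotopic.
- move=> d nd /homotopic_hat cd; apply: normal_path_unique => //.
  exact: homotopic_on_trans ler01 (homotopic_on_sym ler01 cd) hcn.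
(* [cn] takes the values of [c] at the increasing times [sg], so its partition sums occur among
   those of [c]. *)
pose sg x := domL c + ta x * (domR c - domL c).
have gasg x : 0 <= x <= L -> ga x = c (sg x).
  by move=> /gaE[tx ->]; rewrite /hat clamp_id.
(* A partition of [c] starts at [domL c], whereas [sg 0] may be later; [c] has the same value at
   both times. *)
have ga0' : ga 0 = c (domL c) by rewrite ga0 /hat clamp00 mul0r addr0.
have ta01 x : 0 <= x <= L -> 0 <= ta x <= 1 by move=> /gaE[].
apply: ub_ereal_sup => _ [s [/= ps /eqP ls] <-].
(* The empty partition means [L = 0] and has sum [0]; any partition of [c] does, but [c] admits the
   empty one only over a degenerate domain. *)
case: s ps ls => [|x s] ps ls.
  rewrite big_geq //=; have [dc|ndc] := eqVneq (domL c) (domR c).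
    apply: ereal_sup_ubound; exists [::]; first by split; rewrite //= dc.
    by rewrite big_geq.
  have ndc' : domL c < domR c by rewrite lt_neqAle ndc.
  apply: (@le_trans _ _ (mdist (c (domL c)) (c (domR c)))%:E).
    by rewrite lee_fin mdist_ge0.
  apply: ereal_sup_ubound; exists [:: domR c]; first exact: itv_partition1.
  by rewrite big_nat1.
have sin y : y \in x :: s -> 0 < y <= L.
  move=> ys; have /allP -> //= := order_path_min lt_trans ps.
  by rewrite -ls; apply: (path_lt_last ps); rewrite inE ys orbT.
have Lgt0 : 0 < L by have /andP[x0 xL] := sin x (mem_head _ _); exact: lt_le_trans xL.
have ndc : domL c < domR c.
  rewrite lt_neqAle LR andbT; apply/eqP => dc; move: Lgt0.
  by rewrite Lcst ?ltxx // => t; rewrite !hat_degenerate.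
have dc0 : 0 < domR c - domL c by rewrite subr_gt0.
have sg_lt : {in [pred y | 0 <= y <= L] &, {homo sg : y z / y < z}}.
  move=> y z; rewrite !inE => /andP[y0 _] /andP[_ zL] yz.
  by rewrite ltrD2l ltr_pM2r // ta_lt.
pose s' := map sg (x :: s).
apply: ereal_sup_ubound; exists s'.
  split; last by rewrite /= last_map; move: ls => /= ->; rewrite /sg taL mul1r subrKC.
  have all0 : all [pred y | 0 <= y <= L] (0 :: x :: s).
    apply/allP => y; rewrite inE => /predU1P[->|/sin/andP[y0 yL]] /=.
      by rewrite lexx.
    by rewrite ltW.
  have := homo_path_in sg_lt all0 ps; rewrite /= => /andP[h ->]; rewrite andbT.
  apply: le_lt_trans h; rewrite lerDl mulr_ge0 ?(ltW dc0) //.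
  by have /andP[] : 0 <= ta 0 <= 1 by apply: ta01; rewrite lexx.
congr (_%:E); rewrite size_map; apply: eq_big_nat => i /andP[_ ix].
have nthE j : (j <= size (x :: s))%N ->
    c (nth (domR c) (domL c :: s') j) = cn (nth L (0 :: x :: s) j).
  case: j => [_|j jx]; first by rewrite /= ga0'.
  rewrite /= -/(nth L (x :: s) j) (nth_map L) // gasg //.
  by have /andP[/ltW -> ->] := sin _ (mem_nth L jx).
by rewrite !nthE // ltnW.
Qed.
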